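(* Assume that the set $\operatorname{zer}\left(\sum_{i=1}^n A_i+\sum_{i=1}^m B_i+\sum_{i=1}^l C_i\right)$ is nonempty and that the matrices $M,H,G,P,Q,R,K,U$ satisfy all the requirements listed in the context. Let $\{\gamma_k\}_{k\in\mathbb N}\subset[0,1]$ satisfy $\liminf_{k\to\infty}\gamma_k(1-\gamma_k)>0$, let $\mathbf z^0\in\mathcal H^{n-1}$ be arbitrary, and let the sequences $\{\mathbf z^k\}\subset\mathcal H^{n-1}$ and $\{\mathbf x^k\}\subset\mathcal H^n$ be generated by $$\mathbf x^k=\mathbf x(\mathbf z^k),\qquad \mathbf z^{k+1}=\mathbf z^k-\gamma_k\mathbf M^*\mathbf x^k,\qquad k=0,1,2,\dots,$$ that is, $z_j^{k+1}=z_j^k-\gamma_k\sum_{i=1}^n M_{ij}x_i^k$ for $j=1,\dots,n-1$, where $\mathbf x(\cdot)$ is the map defined in the context. Let $T=T_\gamma$ be the operator defined in the context, with any $\gamma>0$. Then: (i) As $k\to\infty$, $(\mathrm{Id}-T)(\mathbf z^k)\to0$ and $\left\|\frac1{k+1}\sum_{s=0}^k(\mathrm{Id}-T)(\mathbf z^s)\right\|=O\left(\frac1{\sqrt k}\right)$. Moreover, $\sum_{i=1}^n t_ix_i^k\to0$ as $k\to\infty$ for all $(t_1,\dots,t_n)\in\mathbb R^n$ with $\sum_{i=1}^nt_i=0$. (ii) The sequence $\{\mathbf z^k\}$ converges weakly to a point $\bar{\mathbf z}=(\bar z_1,\dots,\bar z_{n-1})\in\operatorname{Fix}T$. (iii)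 The sequence $\{\mathbf x^k\}$ converges weakly to $(\bar x,\dots,\bar x)\in\mathcal H^n$, where $$\bar x=J_{d_1A_1}\left(d_1\sum_{j=1}^{n-1}M_{1j}\bar z_j\right)\in\operatorname{zer}\left(\sum_{i=1}^nA_i+\sum_{i=1}^mB_i+\sum_{i=1}^lC_i\right).$$
   Context: Notation. $\mathcal H$ is a real Hilbert space; $\mathcal H^r$ carries the product Hilbert structure. $\mathrm{Id}$ is the identity. $n\ge2$ and $m,l\ge0$ are integers. $e_r\in\mathbb R^r$ is the all-ones vector. For a real $r\times s$ matrix $W$, the bold letter $\mathbf W=W\otimes\mathrm{Id}:\mathcal H^s\to\mathcal H^r$ is the bounded linear operator $(\mathbf W\mathbf x)_i=\sum_{j=1}^sW_{ij}x_j$, and $\mathbf W^*=W^\top\otimes\mathrm{Id}$. $J_{\lambda A}=(\mathrm{Id}+\lambda A)^{-1}$ is the resolvent, $\operatorname{zer}A=\{x:0\in A(x)\}$, $\operatorname{Fix}T=\{z:T(z)=z\}$. $\succeq0$ means positive semidefinite. Operators. $A_i:\mathcal H\rightrightarrows\mathcal H$ ($i=1,\dots,n$) are maximally monotone; $B_i:\mathcal H\to\mathcal H$ ($i=1,\dots,m$) are $\sigma_i$-cocoercive with $\sigma_i>0$, i.e. $\langle B_i(x)-B_i(y),x-y\rangle\ge\sigma_i\|B_i(x)-B_i(y)\|^2$ for all $x,y$; $C_i:\mathcal H\to\mathcal H$ ($i=1,\dots,l$) are monotone and $L_i$-Lipschitz continuous with $L_i>0$. Put $\Sigma=\operatorname{diag}(\sigma_1,\dots,\sigma_m)$,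 $L=\operatorname{diag}(L_1,\dots,L_l)$, $\mathbf A=(A_1,\dots,A_n)$, $\mathbf B=(B_1,\dots,B_m)$, $\mathbf C=(C_1,\dots,C_l)$ (acting componentwise). Causality. For integers $r\geq 0$, a vector $E=(E_1,\dots,E_n)\in\{0,1,\dots,r\}^n$ is $(r,n)$-nondecreasing if $E_1=0$, $E_n=r$ and $E_i\le E_{i+1}$ for $1\le i\le n-1$. $\mathcal S(E)$ is the set of $W\in\mathbb R^{n\times r}$ with $W_{ij}=0$ whenever $j>E_i$; $\mathcal S^c(E)$ is the set of $W\in\mathbb R^{n\times r}$ with $W_{ij}=0$ whenever $j\le E_i$. A pair $H,G^\top\in\mathbb R^{n\times m}$ is causal if there is an $(m,n)$-nondecreasing $E$ with $H\in\mathcal S(E)$ and $G^\top\in\mathcal S^c(E)$. A triple $P,Q,R^\top\in\mathbb R^{n\times l}$ is relatively causal if there are $(l,n)$-nondecreasing vectors $E,F$ with $E_{i-1}\ge F_i$ for $2\le i\le n$ such that $Q\in\mathcal S(F)$, $R^\top\in\mathcal S^c(E)$ and $P\in\mathcal S^c(F)\cap\mathcal S(E)$. Requirements on the matrices. $M\in\mathbb R^{n\times(n-1)}$, $H,G^\top\in\mathbb R^{n\times m}$, $P,Q,R^\top\in\mathbb R^{n\times l}$, $K\in\mathbb R^{n\times n}$, $U\in\mathbb R^{n\times t}$ with $t\ge1$, satisfying: (a) $\ker M^\top\subseteq\mathbb Re_n$; (b) $H^\top e_n=Ge_n=e_m$, $Q^\top e_n=P^\top e_n=Re_n=e_l$,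 $H,G^\top$ are causal, and $P,Q,R^\top$ are relatively causal; (c) $K$ is symmetric, $e_n^\top Ke_n=0$, and $K-MM^\top-\frac12(H-G^\top)\Sigma^{-1}(H^\top-G)-(P-Q)L(P^\top-Q^\top)-(P-R^\top)L(P^\top-R)\succeq0$; specifically $K=MM^\top+UU^\top+\frac12(H-G^\top)\Sigma^{-1}(H^\top-G)+(P-Q)L(P^\top-Q^\top)+(P-R^\top)L(P^\top-R)$. Set $d_i=2/K_{ii}$ for $i=1,\dots,n$, $D=\operatorname{diag}(d_1,\dots,d_n)$, and let $N=-\operatorname{slt}(K)$, where $\operatorname{slt}(K)$ is the strictly lower triangular part of $K$. The map $\mathbf x(\cdot)$ and the operator $T$. For $\mathbf z=(z_1,\dots,z_{n-1})\in\mathcal H^{n-1}$, $\mathbf x(\mathbf z)=(x_1,\dots,x_n)\in\mathcal H^n$ is the unique solution of $$\mathbf x=J_{\mathbf D\mathbf A}\big(\mathbf D\mathbf N\mathbf x+\mathbf D\mathbf M\mathbf z-\mathbf D\mathbf H\mathbf B(\mathbf G\mathbf x)-\mathbf D(\mathbf P-\mathbf Q)\mathbf C(\mathbf R\mathbf x)-\mathbf D\mathbf Q\mathbf C(\mathbf P^*\mathbf x)\big),$$ $J_{\mathbf D\mathbf A}=(J_{d_1A_1},\dots,J_{d_nA_n})$; explicitly, by causality, successively for $i=1,\dots,n$, $$x_i=J_{d_iA_i}\Big(-d_i\sum_{j=1}^{i-1}K_{ij}x_j+d_i\sum_{j=1}^{n-1}M_{ij}z_j-d_i\sum_{j=1}^mH_{ij}B_j\Big(\sum_{h=1}^{i-1}G_{jh}x_h\Big)-d_i\sum_{j=1}^l(P-Q)_{ij}C_j\Big(\sum_{h=1}^{i-1}R_{jh}x_h\Big)-d_i\sum_{j=1}^lQ_{ij}C_j\Big(\sum_{h=1}^{i-1}P_{hj}x_h\Big)\Big).$$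 For $\gamma>0$, $T=T_\gamma:\mathcal H^{n-1}\to\mathcal H^{n-1}$ is $T(\mathbf z)=\mathbf z-\gamma\mathbf M^*\mathbf x(\mathbf z)$. *)

(* Defs.v *)
From HB Require Import structures.
From mathcomp Require Import all_boot all_order all_algebra.
From mathcomp Require Import all_classical all_reals all_analysis.

Set Implicit Arguments.
Unset Strict Implicit.
Unset Printing Implicit Defensive.

Import Order.TTheory GRing.Theory Num.Theory.
Import numFieldNormedType.Exports.

Local Open Scope classical_set_scope.
Local Open Scope ring_scope.

HB.mixin Record CompleteNormedModule_isHilbert (R : realType) V
    & CompleteNormedModule R V := {
  inner : {dot V for @idfun R};
  inner_norm : forall x : V, inner x x = `|x| ^+ 2
}.

#[short(type="hilbertType")]
HB.structure Definition Hilbert (R : realType) :=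
  {V of CompleteNormedModule_isHilbert R V & CompleteNormedModule R V}.

Section product_space.
Context {R : realType} {X : hilbertType R}.

Definition prod_inner r (x y : 'I_r -> X) : R := \sum_i inner (x i) (y i).

Definition prod_norm r (x : 'I_r -> X) : R := Num.sqrt (prod_inner x x).

Definition prod_cvg r (u : nat -> 'I_r -> X) (a : 'I_r -> X) : Prop :=
  (fun k => prod_norm (u k - a)) @ \oo --> (0 : R).

Definition prod_weak_cvg r (u : nat -> 'I_r -> X) (a : 'I_r -> X) : Prop :=
  forall y : 'I_r -> X,
    (fun k => prod_inner (u k) y) @ \oo --> prod_inner a y.

(* W (x) Id : X^s -> X^r *)
Definition mxapp r s (W : 'M[R]_(r, s)) (x : 'I_s -> X) : 'I_r -> X :=
  fun i => \sum_j W i j *: x j.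

End product_space.

Section operators.
Context {R : realType} {X : hilbertType R}.

Definition graph_of (f : X -> X) : X -> set X := fun x => [set f x].

Definition monotone_op (A : X -> set X) : Prop :=
  forall x y u v, A x u -> A y v -> 0 <= inner (x - y) (u - v).

Definition maximally_monotone (A : X -> set X) : Prop :=
  monotone_op A /\
  forall A' : X -> set X,
    monotone_op A' -> (forall x, A x `<=` A' x) -> A' = A.

Definition cocoercive (sigma : R) (B : X -> X) : Prop :=
  forall x y, sigma * `|B x - B y| ^+ 2 <= inner (B x - B y) (x - y).

Definition op_add (A B : X -> set X) : X -> set X :=
  fun x => [set a + b | a in A x & b in B x].

Definition op_sum r (A : 'I_r -> X -> set X) : X -> set X :=
  fun x => [set \sum_i a i | a in [set a : 'I_r -> X | forall i, A i x (a i)]].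

Definition zer (A : X -> set X) : set X := [set x | A x 0].

(* (Id + lambda A)^-1 as a total function. By Minty's theorem the set below is
   a singleton when A is maximally monotone and lambda > 0; the default value
   0 is only taken when it is empty. *)
Definition resolvent (lambda : R) (A : X -> set X) (v : X) : X :=
  xget 0 [set x | exists2 a, A x a & x + lambda *: a = v].

End operators.

Definition Fix (T : Type) (f : T -> T) : set T := [set z | f z = z].

Section matrices.
Context {R : realType}.

Definition psd n (W : 'M[R]_n) : Prop :=
  W^T = W /\ forall v : 'cV[R]_n, 0 <= (v^T *m W *m v) 0 0.

Definition slt n (W : 'M[R]_n) : 'M[R]_n :=
  \matrix_(i, j) (if (j < i)%N then W i j else 0).

(* Indices are 0-based: row i and column j of the mathematics are i.+1 and
   j.+1. The values of E, in {0, ..., r}, count columns and are not shifted. *)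
Definition nondecreasing_vec r n (E : 'I_n -> 'I_r.+1) : Prop :=
  [/\ forall i : 'I_n, i = 0%N :> nat -> E i = 0%N :> nat,
      forall i : 'I_n, i.+1 = n -> E i = r :> nat &
      forall i j : 'I_n, j = i.+1 :> nat -> (E i <= E j)%N].

Definition supp_upto r n (E : 'I_n -> 'I_r.+1) : set 'M[R]_(n, r) :=
  [set W : 'M[R]_(n, r) | forall i (j : 'I_r), (E i < j.+1)%N -> W i j = 0].

Definition supp_after r n (E : 'I_n -> 'I_r.+1) : set 'M[R]_(n, r) :=
  [set W : 'M[R]_(n, r) | forall i (j : 'I_r), (j.+1 <= E i)%N -> W i j = 0].

Definition causal n m (H GT : 'M[R]_(n, m)) : Prop :=
  exists E : 'I_n -> 'I_m.+1,
    [/\ nondecreasing_vec E, supp_upto E H & supp_after E GT].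

Definition relatively_causal n l (P Q RT : 'M[R]_(n, l)) : Prop :=
  exists E F : 'I_n -> 'I_l.+1,
    [/\ nondecreasing_vec E, nondecreasing_vec F &
        forall i j : 'I_n, j = i.+1 :> nat -> (F j <= E i)%N] /\
    [/\ supp_upto F Q, supp_after E RT & (supp_after F `&` supp_upto E) P].

Definition stepsize n (K : 'M[R]_n) : 'rV[R]_n := \row_i (2 / K i i).

End matrices.

Section algorithm.
Context {R : realType} {X : hilbertType R} {n m l : nat}.
Variables (A : 'I_n -> X -> set X) (B : 'I_m -> X -> X) (C : 'I_l -> X -> X).
Variables (M : 'M[R]_(n, n.-1)) (H : 'M[R]_(n, m)) (G : 'M[R]_(m, n)).
Variables (P Q : 'M[R]_(n, l)) (Rmx : 'M[R]_(l, n)) (K : 'M[R]_n).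

Definition componentwise r (f : 'I_r -> X -> X) (x : 'I_r -> X) : 'I_r -> X :=
  fun i => f i (x i).

Definition resolventDA : ('I_n -> X) -> 'I_n -> X :=
  componentwise (fun i => resolvent (stepsize K 0 i) (A i)).

Definition xstep (z : 'I_n.-1 -> X) (x : 'I_n -> X) : 'I_n -> X :=
  let D := mxapp (diag_mx (stepsize K)) in
  let N := - slt K in
  resolventDA
    (D (mxapp N x) + D (mxapp M z)
     - D (mxapp H (componentwise B (mxapp G x)))
     - D (mxapp (P - Q) (componentwise C (mxapp Rmx x)))
     - D (mxapp Q (componentwise C (mxapp P^T x)))).

(* Causality of (H, G) and of (P, Q, Rmx) makes the i-th component of xstep z x
   depend on z and on the components of x before i only, so that the equation
   x = xstep z x has exactly one solution. *)
Definition xmap (z : 'I_n.-1 -> X) : 'I_n -> X :=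
  xget (fun=> 0) [set x | x = xstep z x].

Definition Top (gamma : R) (z : 'I_n.-1 -> X) : 'I_n.-1 -> X :=
  z - gamma *: mxapp M^T (xmap z).

End algorithm.

(* Main.v *)
Require Import Defs.
From mathcomp Require Import all_boot all_order all_algebra.
From mathcomp Require Import all_classical all_reals all_analysis.
From mathcomp Require Import ring lra.

Set Implicit Arguments.
Unset Strict Implicit.
Unset Printing Implicit Defensive.

Import Order.TTheory GRing.Theory Num.Theory.
Import numFieldNormedType.Exports.

Local Open Scope classical_set_scope.
Local Open Scope ring_scope.

(** The proof compares the iterates only with stationary pairs, because T need
    not be nonexpansive. Write [selected z x] for the vector whose i-th entry
    must lie in [A_i x_i] when x solves the implicit equation at z; a pair (z, x)
    is [consistent] when every entry does. Consistent pairs whose x is a constant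
    vector (a, ..., a) correspond to the zeros a of the sum: summing the n
    inclusions kills M z because M^T e = 0 and kills the K-part because
    e^T K e = 0 ([consistent_zeros]); conversely a zero a comes with elements
    u_i of A_i a for which the required value of M z has mean zero, and
    ker M^T being spanned by e makes every mean-zero vector lie in the range
    of M ([zeros_consistent], [centering_factor]).

    Monotonicity of the A_i between a consistent pair (z, x) and a consistent
    pair (z', (a, ..., a)) gives [fejer_inequality],
      |M^T x|^2 / 2 <= <z - z', M^T x>.
    The three quadratic corrections in the definition of K pay for the cross
    terms: the B-term is absorbed by cocoercivity, and in the C-term the values
    at R x and P^T x differ by at most L |R x - P^T x|, a bound that only
    helps against a constant vector, where both arguments agree. Hence
      |z^(k+1) - z'|^2 <= |z^k - z'|^2 - gamma_k (1 - gamma_k) |M^T x^k|^2,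
    so |M^T x^k|^2 is summable, which is part (i): the rate follows from
    |sum of N vectors|^2 <= N (sum of squared norms), and every mean-zero
    combination of the x_i^k is a linear function of M^T x^k.

    For the weak limits, bounded sequences converge weakly along every
    ultrafilter finer than the filter of neighbourhoods of infinity
    ([weak_ultra_cvg]). All points at which the operators are evaluated are
    asymptotically equal to x_1^k while the selected values add up to something
    tending to 0, so [demiclosed_sum] identifies each weak limit as a consistent
    pair (zbar, (a, ..., a)) ([cluster_solution]). As |z^k - zbar| has a limit for
    each such zbar, Opial's argument shows that zbar is the same for all
    ultrafilters ([cluster_unique]), and a is recovered from zbar through the
    first resolvent; so the whole sequences converge weakly.

    Both the resolvents (Minty's theorem) and the weak limits (Riesz
    representation) are obtained from one minimization principle,
    [strongly_convex_min]. *)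

(** * The inner product *)

Section inner_product.
Context {R : realType} {X : hilbertType R}.
Implicit Types (x y z : X) (a : R).

Lemma innerC x y : inner x y = inner y x.
Proof. by rewrite hermC /= expr0 mul1r. Qed.

Lemma innerDl x y z : inner (x + y) z = inner x z + inner y z.
Proof. exact: linearDl. Qed.
Lemma innerDr x y z : inner z (x + y) = inner z x + inner z y.
Proof. exact: linearDr. Qed.
Lemma innerNl x z : inner (- x) z = - inner x z.
Proof. exact: linearNl. Qed.
Lemma innerNr x z : inner z (- x) = - inner z x.
Proof. exact: linearNr. Qed.
Lemma inner0l z : inner (0 : X) z = 0.
Proof. exact: linear0l. Qed.
Lemma inner0r z : inner z (0 : X) = 0.
Proof. exact: linear0r. Qed.
Lemma innerZl a x z : inner (a *: x) z = a * inner x z.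
Proof. exact: linearZl_LR. Qed.
Lemma innerZr a x z : inner z (a *: x) = a * inner z x.
Proof. by rewrite innerC innerZl innerC. Qed.

Definition innerE := (innerDl, innerDr, innerNl, innerNr, innerZl, innerZr).

Lemma inner_suml I (r : seq I) (p : pred I) (F : I -> X) z :
  inner (\sum_(i <- r | p i) F i) z = \sum_(i <- r | p i) inner (F i) z.
Proof. exact: linear_sumlz. Qed.
Lemma inner_sumr I (r : seq I) (p : pred I) (F : I -> X) z :
  inner z (\sum_(i <- r | p i) F i) = \sum_(i <- r | p i) inner z (F i).
Proof. exact: linear_sumr. Qed.

Lemma inner_ge0 x : 0 <= inner x x.
Proof. by rewrite inner_norm exprn_ge0. Qed.

Lemma inner_eq0 x : inner x x = 0 -> x = 0.
Proof. by rewrite inner_norm => /eqP; rewrite sqrf_eq0 normr_eq0 => /eqP. Qed.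

Lemma normr_inner_le x y : `|inner x y| <= `|x| * `|y|.
Proof.
have key (a b : X) : inner a b <= `|a| * `|b|.
  have [->|a0] := eqVneq a 0; first by rewrite inner0l normr0 mul0r.
  have [->|b0] := eqVneq b 0; first by rewrite inner0r normr0 mulr0.
  have := inner_ge0 (`|b| *: a - `|a| *: b).
  rewrite !innerE !inner_norm (innerC b a).
  have na : 0 < `|a| by rewrite normr_gt0.
  have nb : 0 < `|b| by rewrite normr_gt0.
  move=> h; rewrite -subr_ge0 -(pmulr_rge0 _ (mulr_gt0 na nb)).
  nra.
rewrite ler_norml key andbT lerNl -innerNl.
by rewrite (le_trans (key _ _))// normrN.
Qed.

Lemma inner_inj x y : (forall w, inner x w = inner y w) -> x = y.
Proof.
move=> h; apply/eqP; rewrite -subr_eq0; apply/eqP; apply: inner_eq0.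
by rewrite {1}innerDl innerNl h subrr.
Qed.

End inner_product.

(** Two vectors are equal once they have the same inner product with every
    vector, which turns an identity in X into a ring identity in R. *)
Ltac module_ring := apply: inner_inj => ?; rewrite !innerE; ring.

(** * Minimizing a strongly convex function *)

Section strongly_convex_minimum.
Context {R : realType} {X : hilbertType R}.

Lemma cvg_norm_le0 (T : Type) (F : set_system T) {FF : Filter F} (V : normedModType R)
  (f : T -> V) (e : T -> R) :
  (\forall t \near F, `|f t| <= e t) -> e @ F --> (0:R) -> f @ F --> (0 : V).
Proof.
move=> fe e0; apply/norm_cvg0P.
apply: (squeeze_cvgr _ (cvg_cst 0) e0).
by apply: filterS fe => t ft; rewrite normr_ge0.
Qed.

Lemma sqr_dist_cvg (V : completeNormedModType R) (x : nat -> V) (e : nat -> R) :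
  e @ \oo --> (0 : R) ->
  (forall j k, `|x j - x k| ^+ 2 <= e j + e k) -> cvgn x.
Proof.
move=> e0 xe; apply/cauchy_cvgP/cauchy_ballP => eps eps0.
have h : 0 < eps ^+ 2 / 2 by rewrite divr_gt0// exprn_gt0.
have /cvgr_lt /(_ _ h) : e @ \oo --> (0 : R) by [].
move=> He.
exists ((x @` [set k | e k < eps ^+ 2 / 2]), (x @` [set k | e k < eps ^+ 2 / 2])) => /=.
  by split; rewrite /nbhs/= /fmap/=; apply: filterS He => k ?; exists k.
move=> [a b] /= [[j ej <-] [k ek <-]].
rewrite -ball_normE /=.
rewrite -(ltr_pXn2r (n:=2))// ?nnegrE ?(ltW eps0)//.
by apply: le_lt_trans (xe _ _) _; rewrite [ltRHS]splitr ltrD.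
Qed.

(** S plays the epigraph of a convex lower semicontinuous function f on X * X,
    so that f may take the value +oo. Adding half the squared norm makes
    minimizing sequences Cauchy by the parallelogram identity, so the infimum is
    attained without weak compactness; the conclusion is the optimality
    condition that -(x, u) is a subgradient of f at (x, u). *)
Lemma strongly_convex_min (S : X -> X -> R -> Prop) (c : R) :
  (exists x u t, S x u t) ->
  (forall x u t y v s (th : R), 0 <= th <= 1 -> S x u t -> S y v s ->
     S (x + th *: (y - x)) (u + th *: (v - u)) (t + th * (s - t))) ->
  (forall (x u : nat -> X) (t : nat -> R) a b (s : R), (forall k, S (x k) (u k) (t k)) ->
     x @ \oo --> a -> u @ \oo --> b -> t @ \oo --> s -> S a b s) ->
  (forall x u t, S x u t -> c <= t + 2^-1 * (inner x x + inner u u)) ->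
  exists x u t, S x u t /\
    forall y v (s : R), S y v s -> 0 <= (s - t) + inner x (y - x) + inner u (v - u) :> R.
Proof.
move=> [x00 [u00 [t00 S0]]] Sconv Sclosed Sbnd.
pose h (x u : X) (t : R) : R := t + 2^-1 * (inner x x + inner u u).
pose E : set R := [set r | exists x u t, S x u t /\ r = h x u t].
have E0 : has_inf E.
  split; first by exists (h x00 u00 t00), x00, u00, t00.
  by exists c => r [x [u [t [/Sbnd ? ->]]]].
have lbE x u t : S x u t -> inf E <= h x u t.
  by move=> ?; apply: ge_inf; [exact: E0.2|exists x, u, t].
have /choice[p Hp] (k : nat) : exists p : X * X * R,
    S p.1.1 p.1.2 p.2 /\ h p.1.1 p.1.2 p.2 <= inf E + harmonic k.
  have [r [x [u [t [? ->]]]] /ltW hr] := inf_adherent (harmonic_gt0 k) E0.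
  by exists (x, u, t).
have est j k : inner ((p j).1.1 - (p k).1.1) ((p j).1.1 - (p k).1.1)
   + inner ((p j).1.2 - (p k).1.2) ((p j).1.2 - (p k).1.2)
   <= 4 * harmonic j + 4 * harmonic k.
  have [Sj hj] := Hp j; have [Sk hk] := Hp k.
  have h01 : 0 <= (2^-1 : R) <= 1 by lra.
  have := lbE _ _ _ (Sconv _ _ _ _ _ _ _ h01 Sj Sk).
  move: (harmonic j) (harmonic k) hj hk => ej ek hj hk.
  move: hj hk; rewrite /h !innerE.
  move: (p j) (p k) => [[x u] t] [[y v] s] /=.
  rewrite (innerC y x) (innerC v u).
  lra.
have e0 : (fun k => 4 * harmonic k : R) @ \oo --> (0 : R).
  by rewrite -[X in _ --> X](mulr0 4); apply: cvgMl_tmp; exact: cvg_harmonic.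
have cx : cvgn (fun k => (p k).1.1).
  apply: (sqr_dist_cvg e0) => j k; rewrite -inner_norm.
  by apply: le_trans (est j k); rewrite lerDl inner_ge0.
have cu : cvgn (fun k => (p k).1.2).
  apply: (sqr_dist_cvg e0) => j k; rewrite -inner_norm.
  by apply: le_trans (est j k); rewrite lerDr inner_ge0.
have ch : (fun k => h (p k).1.1 (p k).1.2 (p k).2) @ \oo --> inf E.
  apply: (@squeeze_cvgr _ _ _ _ (fun=> inf E) (fun k => inf E + harmonic k)).
  - apply: nearW => k; have [Sk ->] := Hp k; rewrite andbT; exact: lbE.
  - exact: cvg_cst.
  - rewrite -[X in _ --> X]addr0; apply: cvgD; [exact: cvg_cst|exact: cvg_harmonic].
move/cvg_ex: cx => [x cx]; move/cvg_ex: cu => [u cu].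
have cvg2 (f : nat -> X) a : f @ \oo --> a -> (fun k => inner (f k) (f k)) @ \oo --> inner a a.
  move=> fa; rewrite inner_norm; under eq_fun do rewrite inner_norm.
  by under eq_fun do rewrite expr2; rewrite expr2; apply: cvgM; exact: cvg_norm.
pose t := inf E - 2^-1 * (inner x x + inner u u).
have ct : (fun k => (p k).2) @ \oo --> t.
  have -> : (fun k => (p k).2) = (fun k => h (p k).1.1 (p k).1.2 (p k).2
     - 2^-1 * (inner (p k).1.1 (p k).1.1 + inner (p k).1.2 (p k).1.2)).
    by apply/funext => k; rewrite /h addrK.
  by apply: cvgB => //; apply: cvgMl_tmp; apply: cvgD; exact: cvg2.
have Sx : S x u t by apply: (Sclosed _ _ _ _ _ _ _ cx cu ct) => k; case: (Hp k).
exists x, u, t; split=> // y v s Sy.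
(* Move from the minimizer towards (y, v, s) by a fraction th: the increment of
   the objective is th * w + th^2 * q / 2, so the slope w is nonnegative. *)
have hm : h x u t = inf E by rewrite /h subrK.
set q := inner (y - x) (y - x) + inner (v - u) (v - u).
have q0 : 0 <= q by rewrite addr_ge0// inner_ge0.
set w := (X in 0 <= X).
have key th : 0 < th <= 1 -> 0 <= w + th * (2^-1 * q).
  move=> /andP[th0 th1]; have h01 : 0 <= th <= 1 by rewrite ltW.
  have := lbE _ _ _ (Sconv _ _ _ _ _ _ _ h01 Sx Sy).
  rewrite -hm /h -subr_ge0 => H.
  rewrite -(pmulr_rge0 _ th0); apply: le_trans H _.
  rewrite le_eqVlt; apply/orP; left; apply/eqP.
  rewrite /w /q !innerE (innerC y x) (innerC v u).
  by field.
rewrite leNgt; apply/negP => w0.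
(* A step in (0, 1] with th * q <= - w, so that w + th * q / 2 < 0. *)
pose th := - w / (- w + q).
have d0 : 0 < - w + q by lra.
have th0 : 0 < th by rewrite divr_gt0//; lra.
have th1 : th <= 1 by rewrite ler_pdivrMr//; lra.
have := key th; rewrite th0 th1 => /(_ isT).
have : th * q <= - w by rewrite /th mulrAC ler_pdivrMr//; nra.
by move=> ? ?; lra.
Qed.

Lemma cvg_inner (T : Type) (F : set_system T) {FF : Filter F} (f g : T -> X) a b :
  f @ F --> a -> g @ F --> b -> (fun t => inner (f t) (g t)) @ F --> inner a b.
Proof.
move=> fa gb.
have eqn (u v : X) : inner u v = 4^-1 * (`|u + v| ^+ 2 - `|u - v| ^+ 2).
  by rewrite -!inner_norm !innerE (innerC v u); field.
rewrite eqn; under eq_fun do rewrite eqn !expr2; rewrite !expr2.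
have sq (h : T -> X) c : h @ F --> c -> (fun t => `|h t| * `|h t|) @ F --> `|c| * `|c|.
  by move=> hc; apply: cvgM; exact: cvg_norm.
by apply: cvgMl_tmp; apply: cvgB; apply: sq; [exact: cvgD|exact: cvgB].
Qed.

End strongly_convex_minimum.

(** * Maximal monotonicity, Minty's theorem and resolvents *)

Section maximal_monotonicity.
Context {R : realType} {X : hilbertType R}.

(** Otherwise the point (x, u) could be added to the graph. *)
Lemma maximally_monotone_mem (A : X -> set X) x u : maximally_monotone A ->
  (forall y v, A y v -> 0 <= inner (x - y) (u - v)) -> A x u.
Proof.
move=> [Am Amax] H.
rewrite -(Amax (fun y v => A y v \/ (y = x /\ v = u))) => [|{Amax}|y v]; [by right| |by left].
move=> y z v w [Ay|[-> ->]] [Az|[-> ->]].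
- exact: Am Ay Az.
- by rewrite -opprB innerNl -innerNr opprB; exact: H.
- exact: H.
- by rewrite subrr inner0l.
Qed.

Lemma maximally_monotone_nonempty (A : X -> set X) : maximally_monotone A ->
  exists x u, A x u.
Proof.
move=> Am; apply/not_existsP => A0; have A0' x u : ~ A x u by move=> ?; apply: (A0 x); exists u.
by apply: (A0' 0 0); apply: maximally_monotone_mem => // y v /A0'.
Qed.

(** S is the epigraph of the Fitzpatrick function of A, which dominates the
    pairing by maximality and coincides with it on the graph by monotonicity.
    At the minimizer (x, u) of S plus half the squared norm, the optimality
    condition tested on the graph puts (-u, -x) into A by maximality, and tested
    at that very point forces u = -x. *)
Theorem Minty (A : X -> set X) : maximally_monotone A -> exists x, A x (- x).
Proof.
move=> Am; have [a0 [b0 Aab0]] := maximally_monotone_nonempty Am.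
pose S x u t := forall a b, A a b -> inner x b + inner a u - inner a b <= t.
have AS a b : A a b -> S a b (inner a b).
  move=> Aab a' b' Aab'; have := Am.1 _ _ _ _ Aab Aab'.
  by rewrite !innerE; lra.
have SA x u t : S x u t -> inner x u <= t.
  move=> Sx; rewrite leNgt; apply/negP => tx.
  suff /Sx : A x u by lra.
  apply: maximally_monotone_mem => // a b /Sx; rewrite !innerE; lra.
have [||||x [u [t [Sxut xmin]]]] := @strongly_convex_min _ _ S 0.
- by exists a0, b0, (inner a0 b0); exact: AS.
- move=> x u t y v s th /andP[th0 th1] Sx Sy a b Aab.
  have /= Hx := Sx _ _ Aab; have /= Hy := Sy _ _ Aab; rewrite !innerE.
  have : (1 - th) * (inner x b + inner a u - inner a b) +
    th * (inner y b + inner a v - inner a b) <= (1 - th) * t + th * s.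
    by apply: lerD; apply: ler_wpM2l => //; lra.
  lra.
- move=> x u t a b s Sk xa ub ts a' b' Aab.
  have h : (fun k => inner (x k) b' + inner a' (u k) - inner a' b') @ \oo -->
      inner a b' + inner a' b - inner a' b'.
    by apply: cvgB; [apply: cvgD; apply: cvg_inner => //; exact: cvg_cst|exact: cvg_cst].
  by apply: (ler_cvg_to h ts); apply: nearW => k; exact: Sk.
- move=> x u t /SA Sx; have := inner_ge0 (x + u).
  by rewrite !innerE (innerC u x); lra.
have key a b : A a b -> inner (x + u) (x + u) <= inner (- u - a) (- x - b).
  move=> Aab; have := xmin _ _ _ (AS _ _ Aab); have := SA _ _ _ Sxut.
  by rewrite !innerE (innerC u x) (innerC u b) (innerC x a); lra.
have Aux : A (- u) (- x).
  apply: maximally_monotone_mem => // y v /key; apply: le_trans; exact: inner_ge0.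
have /inner_eq0 : inner (x + u) (x + u) = 0.
  apply/eqP; rewrite eq_le inner_ge0 andbT; apply: le_trans (key _ _ Aux) _.
  by rewrite !subrr inner0l.
by move/eqP; rewrite addr_eq0 => /eqP ux; exists x; rewrite {1}ux.
Qed.

(** Minty's theorem for the operator x |-> lambda A x - v. *)
Lemma resolvent_exists (A : X -> set X) lambda v : maximally_monotone A ->
  0 < lambda -> exists x, exists2 a, A x a & x + lambda *: a = v.
Proof.
move=> Am l0; pose A' : X -> set X := fun x w => A x (lambda^-1 *: (w + v)).
have ln0 : lambda != 0 by rewrite gt_eqF.
have A'm : maximally_monotone A'.
  split=> [x y w w' /Am.1 H /H|A2 A2m A2A].
    rewrite -scalerBr innerZr opprD addrACA subrr addr0 pmulr_rge0 ?invr_gt0//.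
  apply/funext => x; apply/seteqP; split => w; last exact: A2A.
  move=> A2w; apply: (maximally_monotone_mem Am) => y b Ay.
  have /A2A A2y : A' y (lambda *: b - v) by rewrite /A' subrK scalerA mulVf// scale1r.
  have := A2m _ _ _ _ A2w A2y.
  have -> : w - (lambda *: b - v) = lambda *: (lambda^-1 *: (w + v) - b).
    by rewrite [RHS]scalerBr scalerA mulfV// scale1r; module_ring.
  by rewrite innerZr pmulr_rge0.
have [x Ax] := Minty A'm; exists x, (lambda^-1 *: (- x + v)) => //.
by rewrite scalerA mulfV// scale1r addNKr.
Qed.

Lemma resolvent_unique (A : X -> set X) lambda x y a b : monotone_op A -> 0 < lambda ->
  A x a -> A y b -> x + lambda *: a = y + lambda *: b -> x = y.
Proof.
move=> Am l0 Ax Ay e; have := Am _ _ _ _ Ax Ay.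
have -> : a - b = - lambda^-1 *: (x - y).
  apply: (scalerI (lt0r_neq0 l0)); rewrite scalerA mulrN mulfV ?gt_eqF//.
  by rewrite -[LHS](addKr x) addrC scalerBr addrA e; module_ring.
rewrite innerZr mulNr oppr_ge0 pmulr_rle0 ?invr_gt0// => h.
apply/eqP; rewrite -subr_eq0; apply/eqP/inner_eq0.
by apply/eqP; rewrite eq_le h inner_ge0.
Qed.

Lemma resolventP (A : X -> set X) d v : maximally_monotone A -> 0 < d ->
  exists2 a, A (resolvent d A v) a & resolvent d A v + d *: a = v.
Proof. by move=> Am d0; have := resolvent_exists v Am d0 => /(xgetPex 0). Qed.

Lemma resolvent_eq (A : X -> set X) d v x a : maximally_monotone A -> 0 < d ->
  A x a -> x + d *: a = v -> resolvent d A v = x.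
Proof.
move=> Am d0 Ax xv; have [b Ab bv] := resolventP v Am d0.
by apply: (resolvent_unique Am.1 d0 Ab Ax); rewrite bv xv.
Qed.

Lemma resolvent_nonexpansive (A : X -> set X) d v w : maximally_monotone A -> 0 < d ->
  `|resolvent d A v - resolvent d A w| <= `|v - w|.
Proof.
move=> Am d0; have [a Aa av] := resolventP v Am d0.
have [b Ab bw] := resolventP w Am d0.
set p := resolvent d A v in Aa av *; set q := resolvent d A w in Ab bw *.
have [->|pq] := eqVneq (p - q) 0; first by rewrite normr0.
have pq0 : 0 < `|p - q| by rewrite normr_gt0.
rewrite -(ler_pM2l pq0) -expr2 -inner_norm.
apply: le_trans (le_trans (ler_norm _) (normr_inner_le (p - q) (v - w))).
have -> : v - w = (p - q) + d *: (a - b) by rewrite -av -bw; module_ring.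
rewrite (innerDr (p - q) (d *: _)) lerDl innerZr pmulr_rge0//.
exact: Am.1 Aa Ab.
Qed.

End maximal_monotonicity.

(** * Weak limits along ultrafilters *)

Section weak_limits.
Context {R : realType} {X : hilbertType R}.

Lemma ultra_bounded_cvg (U : set_system nat) {UU : UltraFilter U}
  (f : nat -> R) c : (forall t, `|f t| <= c) -> exists l : R, f @ U --> l.
Proof.
move=> fc.
have fU : (f @ U) `[- c, c]%classic.
  by apply: nearW => t /=; rewrite in_itv/= -ler_norml.
have [l [_ cl]] := @segment_compact R (- c) c (f @ U) _ fU.
exists l => W Wl; have [//|UW] := in_ultra_setVsetC (f @^-1` W) UU.
by have [r []] := cl (~` W) W UW Wl.
Qed.

Lemma cvg_ultra (F : set_system nat) {FF : Filter F} (V : topologicalType)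
  (f : nat -> V) (l : V) :
  (forall U, UltraFilter U -> F `<=` U -> f @ U --> l) -> f @ F --> l.
Proof.
move=> H W Wl; apply: contrapT => nF.
have nFW : ~ F (f @^-1` W) by [].
have PF : ProperFilter (within (~` (f @^-1` W)) F).
  apply: Build_ProperFilter; rewrite /within /= => F0; apply: nFW; apply: filterS F0 => t.
  by move=> h; apply: contrapT.
have [U [UU FU]] := ultraFilterLemma PF.
have FsU : F `<=` U by move=> B FB; apply: FU; apply: filterS FB.
have UW : U (f @^-1` W) by exact: (H U UU FsU).
have UnW : U (~` (f @^-1` W)) by apply: FU; rewrite /within /=; apply: nearW.
by have /filter_ex[t []] : U (f @^-1` W `&` ~` (f @^-1` W)) by exact: filterI.
Qed.

Lemma cvg_inner_bounded0 (F : set_system nat) {FF : Filter F} (f g : nat -> X) c :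
  f @ F --> (0 : X) -> (forall t, `|g t| <= c) -> (fun t => inner (f t) (g t)) @ F --> (0 : R).
Proof.
move=> f0 gc.
have h t : `|inner (f t) (g t)| <= `|f t| * c.
  by apply: le_trans (normr_inner_le _ _) _; exact: ler_wpM2l.
apply: (@cvg_norm_le0 R _ _ _ R^o _ (fun t => `|f t| * c)); first exact: nearW.
by rewrite -(mul0r c) -(normr0 X); apply: cvgMr_tmp; apply: cvg_norm.
Qed.

Lemma cvg_sum (V : normedModType R) (F : set_system nat) {FF : Filter F} (I : Type)
  (r : seq I) (P : pred I) (f : I -> nat -> V) (l : I -> V) :
  (forall i, P i -> f i @ F --> l i) ->
  (fun k => \sum_(i <- r | P i) f i k) @ F --> \sum_(i <- r | P i) l i.
Proof. by move=> fl; apply: cvg_big => //; exact: add_continuous. Qed.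

(** The limits of the inner products with y define a bounded linear functional
    f of y; the point representing f is the minimizer of |x|^2 / 2 - f x. *)
Lemma weak_ultra_cvg (U : set_system nat) {UU : UltraFilter U}
  (u : nat -> X) c : (forall t, `|u t| <= c) ->
  exists a, forall y, (fun t => inner (u t) y) @ U --> inner a y.
Proof.
move=> uc.
have /choice[f fP] (y : X) : exists l : R, (fun t => inner (u t) y) @ U --> l.
  apply: (ultra_bounded_cvg (c := c * `|y|)) => t.
  by apply: le_trans (normr_inner_le _ _) _; exact: ler_wpM2r.
have fu y l : (fun t => inner (u t) y) @ U --> l -> f y = l.
  by move=> h; apply: (cvg_unique _ (fP y) h).
have fD y z : f (y + z) = f y + f z.
  by apply: fu; under eq_fun do rewrite innerDr; exact: cvgD.
have fZ a y : f (a *: y) = a * f y.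
  by apply: fu; under eq_fun do rewrite innerZr; exact: cvgMl_tmp.
have fN y : f (- y) = - f y by rewrite -scaleN1r fZ mulN1r.
have fc y : `|f y| <= c * `|y|.
  apply: (ler_cvg_to (cvg_norm (fP y)) (cvg_cst (c * `|y|))).
  apply: nearW => t; apply: le_trans (normr_inner_le _ _) _; exact: ler_wpM2r.
(* The second variable of the minimization principle is left free. *)
pose S (x v : X) (t : R) := - f x <= t.
have [||||x [v [t [Sx xmin]]]] := @strongly_convex_min _ _ S (- (2^-1 * c ^+ 2)).
- by exists 0, 0, (- f 0); rewrite /S.
- move=> x v t y w s th /andP[th0 th1]; rewrite /S !(fD, fZ, fN) => Sx Sy.
  have : (1 - th) * (- f x) + th * - f y <= (1 - th) * t + th * s.
    by apply: lerD; apply: ler_wpM2l => //; lra.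
  lra.
- move=> x v t a b s Sk xa _ ts.
  apply: (ler_cvg_to (f := fun k => - f (x k)) _ ts); last by apply: nearW => k; exact: Sk.
  apply: cvgN; apply: cvg_zero => /=.
  apply: (@cvg_norm_le0 _ _ _ _ _ _ (fun k => c * `|x k - a|)).
    by apply: nearW => k /=; rewrite -[X in X <= _]/(`|f (x k) - f a|) -fN -fD; exact: fc.
  rewrite -(mulr0 c) -(normr0 X); apply: cvgMl_tmp; apply: cvg_norm.
  by rewrite -(subrr a); apply: cvgB => //; exact: cvg_cst.
- move=> x v t Sx; have := ler_norm (f x); have := fc x; have := inner_ge0 v.
  rewrite inner_norm (inner_norm x); rewrite /S in Sx.
  have : 0 <= (c - `|x|) ^+ 2 by exact: sqr_ge0.
  by rewrite sqrrB; lra.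
exists x => y; suff <- : f y = inner x y by exact: fP.
have key w : f w <= inner x w.
  have := xmin (x + w) v (- f (x + w)); rewrite /S lexx => /(_ isT).
  by rewrite subrr inner0r addr0 [x + w]addrC addrK fD; rewrite /S in Sx; lra.
by apply/eqP; rewrite eq_le key/= -lerN2 -fN -innerNr key.
Qed.

(** In the limit the sum over i of <xbar - a_i, qbar_i - b_i> is nonnegative for
    all choices of graph points (a_i, b_i), because sum_i <p_i, q_i> tends to
    0 = sum_i <xbar, qbar_i>. If (xbar, qbar_i) missed the graph for one i,
    maximality would provide graph points making that summand negative and the
    others nonpositive. *)
Lemma demiclosed_sum (F : set_system nat) {FF : ProperFilter F} (I : finType)
  (O : I -> X -> set X) (p q : nat -> I -> X) (y : nat -> X) c xbar (qbar : I -> X) :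
  (forall i x u, (forall y v, O i y v -> 0 <= inner (x - y) (u - v)) -> O i x u) ->
  (forall i, monotone_op (O i)) ->
  (forall t i, O i (p t i) (q t i)) ->
  (forall i, (fun t => p t i - y t) @ F --> (0 : X)) ->
  (forall t, `|y t| <= c) -> (forall t i, `|q t i| <= c) ->
  (forall w, (fun t => inner (y t) w) @ F --> inner xbar w) ->
  (forall i w, (fun t => inner (q t i) w) @ F --> inner (qbar i) w) ->
  (fun t => \sum_i q t i) @ F --> (0 : X) ->
  forall i, O i xbar (qbar i).
Proof.
move=> Omax Omon Opq py yc qc yx qq q0 i0; apply: contrapT => nO.
have sqbar : \sum_i qbar i = 0.
  apply: inner_inj => w; rewrite inner0l inner_suml.
  have h1 : (fun t => \sum_i inner (q t i) w) @ F --> \sum_i inner (qbar i) w.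
    by apply: cvg_sum => i _; exact: qq.
  have h2 : (fun t => \sum_i inner (q t i) w) @ F --> (0 : R).
    have -> : (fun t => \sum_i inner (q t i) w) = (fun t => inner (\sum_i q t i) w).
      by apply/funext => t; rewrite inner_suml.
    rewrite -(inner0l w).
    by apply: cvg_inner => //; exact: cvg_cst.
  exact: (cvg_unique _ h1 h2).
have strict i : ~ O i xbar (qbar i) ->
    exists ab : X * X, O i ab.1 ab.2 /\ inner (xbar - ab.1) (qbar i - ab.2) < 0.
  move=> ni; apply/not_existsP => h; apply: ni; apply: Omax => a b Oab.
  by rewrite leNgt; apply/negP => ?; apply: (h (a, b)).
have /choice[ab abP] i : exists ab : X * X, O i ab.1 ab.2 /\
    inner (xbar - ab.1) (qbar i - ab.2) <= 0 /\
    (i = i0 -> inner (xbar - ab.1) (qbar i - ab.2) < 0).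
  have [Oi|/strict[ab [? lt0]]] := pselect (O i xbar (qbar i)).
    exists (xbar, qbar i); split => //=; rewrite subrr inner0l; split=> // ii0.
    by move: Oi; rewrite ii0.
  by exists ab; split=> //; split=> //; exact: ltW.
have neg : \sum_i inner (xbar - (ab i).1) (qbar i - (ab i).2) < 0.
  rewrite (bigD1 i0)//= ltr_wnDr ?(abP i0).2.2//.
  by apply: sumr_le0 => i _; exact: (abP i).2.1.
have lim : (fun t => \sum_i inner (p t i - (ab i).1) (q t i - (ab i).2)) @ F -->
    \sum_i inner (xbar - (ab i).1) (qbar i - (ab i).2).
  (* Rewrite both sides so that every product of two nonconstant factors
     contains a factor tending strongly to 0. *)
  have -> : \sum_i inner (xbar - (ab i).1) (qbar i - (ab i).2) =
    (inner (\sum_i qbar i) xbar + \sum_i ((0 - inner (0 : X) (ab i).2 - inner xbar (ab i).2)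
      - (inner (qbar i) (ab i).1 - inner (ab i).1 (ab i).2))).
    rewrite inner_suml -big_split/=; apply: eq_bigr => i _.
    rewrite !innerE inner0l (innerC (ab i).1 (qbar i)) (innerC (qbar i) xbar).
    by ring.
  rewrite sqbar inner0l.
  have -> : (fun t => \sum_i inner (p t i - (ab i).1) (q t i - (ab i).2)) =
    (fun t => inner (\sum_i q t i) (y t) + \sum_i
     ((inner (p t i - y t) (q t i) - inner (p t i - y t) (ab i).2
       - inner (y t) (ab i).2)
      - (inner (q t i) (ab i).1 - inner (ab i).1 (ab i).2))).
    apply/funext => t; rewrite inner_suml -big_split/=; apply: eq_bigr => i _.
    by rewrite !innerE (innerC (ab i).1 (q t i)) (innerC (q t i) (y t)); ring.
  apply: cvgD; first exact: (cvg_inner_bounded0 q0 yc).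
  apply: cvg_sum => i _; apply: cvgB; apply: cvgB.
  - apply: cvgB; first by apply: (cvg_inner_bounded0 (py i)) => t; exact: qc.
    by apply: cvg_inner => //; exact: cvg_cst.
  - exact: yx.
  - exact: qq.
  - exact: cvg_cst.
have : 0 <= \sum_i inner (xbar - (ab i).1) (qbar i - (ab i).2).
  apply: (ler_cvg_to (cvg_cst 0) lim); apply: nearW => t.
  by apply: sumr_ge0 => i _; apply: Omon (Opq t i) (abP i).1.
by rewrite leNgt neg.
Qed.

End weak_limits.

(** * Real sequences *)

Section real_sequences.
Context {R : realType}.

Lemma limn_inf_gt0 (g : nat -> R) : (forall k, `|g k| <= 1) -> 0 < limn_inf g ->
  exists d N, 0 < d /\ forall k, (N <= k)%N -> d <= g k.
Proof.
move=> g1; have bg : bounded_fun g.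
  by exists 1; split; rewrite ?num_real// => M M1 k _; apply: le_trans (g1 k) (ltW M1).
rewrite limn_infE// => /sup_gt [|_ [N _ <-] gN]; first by exists (infs g 0), 0.
exists (infs g N), N; split=> // k Nk; apply: ge_inf; last by exists k.
by exists (- 1) => _ [j _ <-]; have := g1 j; rewrite ler_norml => /andP[].
Qed.

Lemma summable_of_descent (a s g : nat -> R) :
  (forall k, 0 <= a k) -> (forall k, 0 <= s k) -> (forall k, 0 <= g k <= 1) ->
  0 < limn_inf g -> (forall k, a k.+1 <= a k - g k * s k) ->
  exists c, 0 <= c /\ forall k, \sum_(0 <= i < k) s i <= c.
Proof.
move=> a0 s0 g01 g_inf ag.
have [|d [N [d0 dg]]] := limn_inf_gt0 _ g_inf.
  by move=> k; have /andP[g0 g1] := g01 k; rewrite ger0_norm.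
pose S k := \sum_(0 <= i < k) s i.
(* N is the rank from which g >= d. Below it the descent only says that a does
   not increase, hence the compensating sum up to min(k, N). *)
have key k : d * S k + a k <= a 0%N + d * S (minn k N).
  rewrite /S; elim: k => [|k IH].
    by rewrite min0n !big_geq// mulr0 addr0 add0r.
  rewrite big_nat_recr//=; have := ag k.
  have /andP[g0 _] := g01 k; have := mulr_ge0 g0 (s0 k).
  have [kN|Nk] := ltnP k N.
    rewrite (minn_idPl kN) big_nat_recr//=.
    by rewrite (minn_idPl (ltnW kN)) in IH; lra.
  rewrite (minn_idPr (leqW Nk)); rewrite (minn_idPr Nk) in IH.
  by have := ler_wpM2r (s0 k) (dg k Nk); lra.
have SN k : S (minn k N) <= S N.
  rewrite /S (@big_cat_nat _ _ _ (minn k N) 0 N)//= ?geq_minr//.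
  by rewrite lerDl; apply: sumr_ge0 => i _; exact: s0.
exists (d^-1 * (a 0%N + d * S N)); split.
  apply: mulr_ge0; first by rewrite invr_ge0 ltW.
  by apply: addr_ge0 => //; apply: mulr_ge0; [exact: ltW|apply: sumr_ge0].
move=> k; rewrite ler_pdivlMl//; have := key k; have := ler_wpM2l (ltW d0) (SN k).
by have := a0 k; rewrite -/(S k); lra.
Qed.

Lemma summable_cvg0 (s : nat -> R) c : (forall k, 0 <= s k) ->
  (forall k, \sum_(0 <= i < k) s i <= c) -> s @ \oo --> (0 : R).
Proof.
move=> s0 sc; apply: cvg_series_cvg_0; apply: nondecreasing_is_cvgn.
  by apply/nondecreasing_seqP => k; rewrite /series/= big_nat_recr//= lerDl.
by exists c => _ [k _ <-]; exact: sc.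
Qed.

Lemma sqrtr_cvg0 (f : nat -> R) : f @ \oo --> (0 : R) -> (fun k => Num.sqrt (f k)) @ \oo --> (0 : R).
Proof.
by move=> f0; rewrite -(@sqrtr0 R); apply: continuous_cvg => //; exact: sqrt_continuous.
Qed.

End real_sequences.

(** * Matrix identities *)

Section matrix_facts.
Context {R : realType}.

Lemma trmxB r s (V V' : 'M[R]_(r, s)) : (V - V')^T = V^T - V'^T.
Proof. exact: linearB. Qed.

Lemma row_sum1 r s (V : 'M[R]_(r, s)) : V *m const_mx 1 = const_mx 1 :> 'cV[R]_r ->
  forall i, \sum_j V i j = 1.
Proof.
move=> /matrixP V1 i; have := V1 i 0; rewrite !mxE => <-.
by apply: eq_bigr => j _; rewrite mxE mulr1.
Qed.

Lemma col_sum1 r s (V : 'M[R]_(r, s)) : V^T *m const_mx 1 = const_mx 1 :> 'cV[R]_s ->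
  forall j, \sum_i V i j = 1.
Proof.
by move=> /row_sum1 V1 j; rewrite -[RHS](V1 j); apply: eq_bigr => i _; rewrite mxE.
Qed.

Lemma invmx_diag m (d : 'rV[R]_m) : (forall i, 0 < d 0 i) ->
  invmx (diag_mx d) = diag_mx (\row_i (d 0 i)^-1).
Proof.
move=> d0; have h : diag_mx (\row_i (d 0 i)^-1) *m diag_mx d = 1%:M.
  apply/matrixP => i j; rewrite mul_diag_mx !mxE.
  have [->|] := eqVneq i j; last by rewrite mulr0n mulr0.
  by rewrite !mulr1n mulVf ?gt_eqF.
by rewrite -[LHS]mul1mx -h -mulmxA mulmxV ?mulmx1//; case/mulmx1_unit: h.
Qed.

(** This is D^-1 - N in terms of the stepsizes d_i = 2 / K_ii and of
    N = - slt K, the linear part of the implicit equation once the resolvents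
    are undone. *)
Definition half_lower n (K : 'M[R]_n) : 'M[R]_n := slt K + diag_mx (\row_i (K i i / 2)).

Lemma half_lowerE n (K : 'M[R]_n) : K^T = K -> K = half_lower K + (half_lower K)^T.
Proof.
move=> Ks; apply/matrixP => i j; rewrite !mxE.
have Kij : K j i = K i j by rewrite -[in LHS]Ks mxE.
have [->|ij] := eqVneq i j; first by rewrite ltnn !mulr1n !add0r -splitr.
rewrite !mulr0n !addr0 Kij.
by case: ltngtP ij => [_ _|_ _|/val_inj ->]; rewrite ?addr0 ?add0r ?eqxx.
Qed.

(** half_lower K and its transpose have the same sum of entries and add up to
    K. *)
Lemma half_lower_cst n (K : 'M[R]_n) : K^T = K ->
  (const_mx 1 : 'rV[R]_n) *m K *m (const_mx 1 : 'cV[R]_n) = 0 ->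
  \sum_i \sum_j half_lower K i j = 0.
Proof.
move=> Ks /matrixP/(_ 0 0); rewrite !mxE => K0.
have : \sum_i \sum_j K i j = 0.
  rewrite -[RHS]K0 exchange_big/=; apply: eq_bigr => j _; rewrite !mxE mulr1.
  by apply: eq_bigr => i _; rewrite mxE mul1r.
have -> : \sum_i \sum_j K i j = (\sum_i \sum_j half_lower K i j) *+ 2.
  rewrite mulr2n [X in _ = _ + X]exchange_big/= -big_split/=.
  apply: eq_bigr => i _; rewrite -big_split/=; apply: eq_bigr => j _.
  by rewrite [in LHS](half_lowerE Ks) mxE [X in _ + X]mxE.
by move/eqP; rewrite mulrn_eq0/= => /eqP.
Qed.

Lemma gram_form r s (W : 'M[R]_(r, s)) (d : 'rV[R]_s) (v : 'cV[R]_r) :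
  (v^T *m (W *m diag_mx d *m W^T) *m v) 0 0 = \sum_j d 0 j * ((W^T *m v) j 0) ^+ 2.
Proof.
have -> : v^T *m (W *m diag_mx d *m W^T) *m v =
    (W^T *m v)^T *m (diag_mx d *m (W^T *m v)).
  by rewrite trmx_mul trmxK !mulmxA.
rewrite mxE; apply: eq_bigr => j _; rewrite mul_diag_mx !mxE.
by rewrite mulrCA expr2.
Qed.

(** A row vector is in the row space of M^T as soon as it annihilates the
    cokernel of M^T, whose columns lie in ker M^T and so are multiples of the
    all-ones vector. *)
Lemma centering_factor n s (M : 'M[R]_(n, s)) : (0 < n)%N ->
  (forall v : 'cV[R]_n, M^T *m v = 0 -> exists c : R, v = c *: const_mx 1) ->
  exists S : 'M[R]_(s, n), M *m S = 1%:M - n%:R^-1 *: const_mx 1.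
Proof.
move=> n0 Mker; set W : 'M[R]_n := _ - _.
have WT : W^T = W.
  by apply/matrixP => i j; rewrite !mxE eq_sym.
have We : W *m const_mx 1 = 0 :> 'cV[R]_n.
  rewrite mulmxBl mul1mx -scalemxAl; apply/matrixP => i j; rewrite !mxE.
  under eq_bigr do rewrite !mxE mulr1.
  by rewrite sumr_const card_ord mulVf ?subrr// pnatr_eq0 -lt0n.
have : (W <= M^T)%MS.
  rewrite submxE; apply/eqP/matrixP => i j.
  have /Mker[c cE] : M^T *m col j (cokermx M^T) = 0.
    by rewrite colE mulmxA mulmx_coker mul0mx.
  have /matrixP/(_ i 0) : W *m col j (cokermx M^T) = 0.
    by rewrite cE -scalemxAr We scaler0.
  by rewrite colE mulmxA -colE !mxE.
case/submxP => S WS; exists S^T.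
by rewrite -[M]trmxK -trmx_mul -WS WT.
Qed.

End matrix_facts.

(** * The operators induced by real matrices *)

Section mxapp_theory.
Context {R : realType} {X : hilbertType R}.

Lemma mxappD r s (W V : 'M[R]_(r, s)) (x : 'I_s -> X) :
  mxapp (W + V) x = mxapp W x + mxapp V x.
Proof.
apply/funext => i; rewrite !fctE /mxapp -big_split/=.
by apply: eq_bigr => j _; rewrite mxE scalerDl.
Qed.

Lemma mxappN r s (W : 'M[R]_(r, s)) (x : 'I_s -> X) : mxapp (- W) x = - mxapp W x.
Proof.
apply/funext => i; rewrite !fctE /mxapp -sumrN.
by apply: eq_bigr => j _; rewrite mxE scaleNr.
Qed.

Lemma mxappB r s (W V : 'M[R]_(r, s)) (x : 'I_s -> X) :
  mxapp (W - V) x = mxapp W x - mxapp V x.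
Proof. by rewrite mxappD mxappN. Qed.

Lemma mxappBr r s (W : 'M[R]_(r, s)) (x y : 'I_s -> X) :
  mxapp W (x - y) = mxapp W x - mxapp W y.
Proof.
apply/funext => i; rewrite !fctE /mxapp -sumrB.
by apply: eq_bigr => j _; rewrite scalerBr.
Qed.

Lemma mxapp_mul r s t (W : 'M[R]_(r, s)) (V : 'M[R]_(s, t)) (x : 'I_t -> X) :
  mxapp (W *m V) x = mxapp W (mxapp V x).
Proof.
apply/funext => i; rewrite /mxapp.
under [RHS]eq_bigr do rewrite scaler_sumr.
rewrite exchange_big/=; apply: eq_bigr => j _.
by rewrite mxE scaler_suml; apply: eq_bigr => k _; rewrite scalerA.
Qed.

Lemma mxapp_cst r s (W : 'M[R]_(r, s)) (a : X) i :
  mxapp W (fun=> a) i = (\sum_j W i j) *: a.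
Proof. by rewrite /mxapp scaler_suml. Qed.

Lemma prod_innerDl r (x y z : 'I_r -> X) :
  prod_inner (x + y) z = prod_inner x z + prod_inner y z.
Proof. by rewrite /prod_inner -big_split; apply: eq_bigr => i _; rewrite !fctE innerDl. Qed.

Lemma prod_innerNl r (x z : 'I_r -> X) : prod_inner (- x) z = - prod_inner x z.
Proof. by rewrite /prod_inner -sumrN; apply: eq_bigr => i _; rewrite !fctE innerNl. Qed.

Lemma prod_innerBl r (x y z : 'I_r -> X) :
  prod_inner (x - y) z = prod_inner x z - prod_inner y z.
Proof. by rewrite prod_innerDl prod_innerNl. Qed.

Lemma prod_innerC r (x y : 'I_r -> X) : prod_inner x y = prod_inner y x.
Proof. by apply: eq_bigr => i _; exact: innerC. Qed.

Lemma prod_innerZl r (c : R) (x z : 'I_r -> X) : prod_inner (c *: x) z = c * prod_inner x z.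
Proof. by rewrite /prod_inner mulr_sumr; apply: eq_bigr => i _; rewrite !fctE innerZl. Qed.

Lemma prod_inner_ge0 r (x : 'I_r -> X) : 0 <= prod_inner x x.
Proof. by apply: sumr_ge0 => i _; exact: inner_ge0. Qed.

Lemma mxapp_adj r s (W : 'M[R]_(r, s)) (x : 'I_s -> X) (y : 'I_r -> X) :
  prod_inner (mxapp W x) y = prod_inner x (mxapp W^T y).
Proof.
rewrite /prod_inner /mxapp; under eq_bigr do rewrite inner_suml.
rewrite exchange_big/=; apply: eq_bigr => j _; rewrite inner_sumr.
by apply: eq_bigr => i _; rewrite innerZl innerZr mxE.
Qed.

Lemma mxapp_diag r (d : 'rV[R]_r) (x : 'I_r -> X) i :
  mxapp (diag_mx d) x i = d 0 i *: x i.
Proof.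
rewrite /mxapp (bigD1 i)//= mxE eqxx mulr1n big1 ?addr0// => j ji.
by rewrite mxE eq_sym (negbTE ji) mulr0n scale0r.
Qed.

Lemma mxapp_weighted_gram r s (W : 'M[R]_(r, s)) (d : 'rV[R]_s) (x : 'I_r -> X) :
  prod_inner (mxapp (W *m diag_mx d *m W^T) x) x =
  \sum_j d 0 j * inner (mxapp W^T x j) (mxapp W^T x j).
Proof.
rewrite -mulmxA 2!mxapp_mul mxapp_adj /prod_inner.
by apply: eq_bigr => j _; rewrite mxapp_diag innerZl.
Qed.

Lemma mxappZ r s (c : R) (W : 'M[R]_(r, s)) (x : 'I_s -> X) :
  mxapp (c *: W) x = c *: mxapp W x.
Proof.
apply/funext => i; rewrite !fctE /mxapp scaler_sumr.
by apply: eq_bigr => j _; rewrite mxE scalerA.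
Qed.

Lemma mxapp_cst1 r s (V : 'M[R]_(r, s)) (a : X) :
  V *m const_mx 1 = const_mx 1 :> 'cV[R]_r -> mxapp V (fun=> a) = fun=> a.
Proof.
by move=> /row_sum1 V1; apply/funext => i; rewrite mxapp_cst V1 scale1r.
Qed.

Lemma sum_mxapp r s (V : 'M[R]_(r, s)) (y : 'I_s -> X) :
  \sum_i mxapp V y i = \sum_j (\sum_i V i j) *: y j.
Proof.
by rewrite /mxapp exchange_big/=; apply: eq_bigr => j _; rewrite scaler_suml.
Qed.

Lemma mxapp1 r (x : 'I_r -> X) : mxapp 1%:M x = x.
Proof.
apply/funext => i; rewrite /mxapp (bigD1 i)//= mxE eqxx scale1r big1 ?addr0// => j ji.
by rewrite mxE eq_sym (negbTE ji) scale0r.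
Qed.

Lemma mxapp_centering r (c : R) (x : 'I_r -> X) i :
  mxapp (1%:M - c *: const_mx 1) x i = x i - c *: \sum_j x j.
Proof.
rewrite mxappB mxapp1 mxappZ !fctE; congr (_ - _ *: _).
by apply: eq_bigr => j _; rewrite mxE scale1r.
Qed.

Lemma prod_norm2B r (u w : 'I_r -> X) (c : R) :
  prod_inner (u - c *: w) (u - c *: w) =
  prod_inner u u - 2 * c * prod_inner u w + c ^+ 2 * prod_inner w w.
Proof.
rewrite /prod_inner !mulr_sumr -sumrB -big_split/=; apply: eq_bigr => i _.
by rewrite !fctE !innerE (innerC (w i)); ring.
Qed.

Lemma prod_normZ r (c : R) (u : 'I_r -> X) : prod_norm (c *: u) = `|c| * prod_norm u.
Proof.
rewrite /prod_norm prod_innerZl prod_innerC prod_innerZl mulrA -expr2.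
by rewrite sqrtrM ?sqr_ge0// sqrtr_sqr.
Qed.

Lemma inner_le_prod r (u : 'I_r -> X) j : inner (u j) (u j) <= prod_inner u u.
Proof.
rewrite /prod_inner (bigD1 j)//= lerDl; apply: sumr_ge0 => i _; exact: inner_ge0.
Qed.

(** Each of the N^2 products <v_s, v_t> is at most (|v_s|^2 + |v_t|^2) / 2. *)
Lemma prod_inner_sum_le r (v : nat -> 'I_r -> X) N :
  prod_inner (\sum_(0 <= s < N) v s) (\sum_(0 <= s < N) v s) <=
  N%:R * \sum_(0 <= s < N) prod_inner (v s) (v s).
Proof.
rewrite !big_mkord.
have sumE i : (\sum_(s < N) v s) i = \sum_(s < N) v s i.
  by elim/big_rec2 : _ => // s a b _ <-; rewrite fctE.
have -> : prod_inner (\sum_(s < N) v s) (\sum_(s < N) v s) =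
    \sum_(s < N) \sum_(t < N) prod_inner (v s) (v t).
  rewrite /prod_inner; under eq_bigr do rewrite sumE inner_suml.
  rewrite exchange_big/=; apply: eq_bigr => s _.
  under eq_bigr do rewrite inner_sumr.
  by rewrite exchange_big.
have -> : N%:R * \sum_(s < N) prod_inner (v s) (v s) =
    \sum_(s < N) \sum_(t < N) 2^-1 * (prod_inner (v s) (v s) + prod_inner (v t) (v t)).
  under [RHS]eq_bigr do (rewrite -mulr_sumr big_split/= sumr_const card_ord).
  rewrite -mulr_sumr big_split/= sumr_const card_ord.
  rewrite sumrMnl; set q := \sum_(i < N) _.
  by rewrite -(mulr_natl q N); lra.
apply: ler_sum => s _; apply: ler_sum => t _.
have := prod_inner_ge0 (v s - v t).
rewrite !prod_innerBl 2!(prod_innerC _ (v s - v t)) !prod_innerBl (prod_innerC (v t) (v s)).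
lra.
Qed.

End mxapp_theory.

(** * Cocoercive and Lipschitz operators *)

Section lipschitz_operators.
Context {R : realType} {X : hilbertType R}.

Lemma lipschitzE (k : R) (f : X -> X) :
  k.-lipschitz f -> forall x y, `|f x - f y| <= k * `|x - y|.
Proof. by move=> fk x y; exact: (fk (x, y) (conj I I)). Qed.

Lemma cocoercive_lipschitz (f : X -> X) s : 0 < s -> cocoercive s f ->
  forall x y, `|f x - f y| <= s^-1 * `|x - y|.
Proof.
move=> s0 fs x y; rewrite ler_pdivlMl//.
have [->|f0] := eqVneq (f x - f y) 0; first by rewrite normr0 mulr0.
have p0 : 0 < `|f x - f y| by rewrite normr_gt0.
rewrite -(ler_pM2l p0) mulrCA -expr2.
exact: le_trans (fs x y) (le_trans (ler_norm _) (normr_inner_le _ _)).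
Qed.

(** If e = u - f x were nonzero, testing at y = x + s e with a small s > 0 would
    give <- s e, e + o(1)> < 0. *)
Lemma lipschitz_graph_maximal (f : X -> X) k : 0 < k ->
  (forall x y, `|f x - f y| <= k * `|x - y|) ->
  forall x u, (forall y v, graph_of f y v -> 0 <= inner (x - y) (u - v)) -> graph_of f x u.
Proof.
move=> k0 fk x u H; rewrite /graph_of /=; set e := u - f x.
(* With this s the increment of f is at most |e| / 2. *)
pose s := (2 * k)^-1; have s0 : 0 < s by rewrite invr_gt0 mulr_gt0.
have := H (x + s *: e) _ erefl.
have -> : x - (x + s *: e) = - s *: e by module_ring.
have -> : u - f (x + s *: e) = e - (f (x + s *: e) - f x) by rewrite /e; module_ring.
rewrite innerZl mulNr oppr_ge0 pmulr_rle0// innerDr innerNr inner_norm => le0.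
have h1 : inner e (f (x + s *: e) - f x) <= 2^-1 * `|e| ^+ 2.
  apply: le_trans (ler_norm _) _; apply: le_trans (normr_inner_le _ _) _.
  have h := fk (x + s *: e) x.
  have e1 : k * `|x + s *: e - x| = 2^-1 * `|e|.
    rewrite addrC addKr normrZ gtr0_norm// mulrA; congr (_ * _).
    by rewrite /s invfM mulrCA mulfV ?mulr1// gt_eqF.
  rewrite e1 in h; rewrite expr2 mulrCA; exact: ler_wpM2l.
have : `|e| ^+ 2 <= 0 by lra.
rewrite exprn_even_le0//= normr_eq0 => /eqP e0.
by apply/eqP; rewrite -subr_eq0 -/e e0.
Qed.

(** Complete the square in s b + (v - u) / 2. *)
Lemma cocoercive_cross (s : R) (b u v : X) : 0 < s -> s * inner b b <= inner b u ->
  - inner b v <= 4^-1 * (s^-1 * inner (v - u) (v - u)).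
Proof.
move=> s0 bu; have := inner_ge0 (s *: b + 2^-1 *: (v - u)) => h.
rewrite mulrCA ler_pdivlMl//.
move: h; rewrite !innerE (innerC v b) (innerC u b) (innerC u v).
nra.
Qed.

(** Here c and c' stand for the increments of one monotone Lipschitz operator
    from a reference point to the points at displacements r and p from it.
    Regrouping gives -<c - c', p - q> - <c', p>, where the second term is
    nonpositive by monotonicity and the first is bounded by
    s |r - p| |p - q|. *)
Lemma lipschitz_cross (s : R) (c c' r p q : X) : 0 < s -> 0 <= inner c' p ->
  `|c - c'| <= s * `|r - p| ->
  - inner c (p - q) - inner c' q <=
  2^-1 * (s * inner (p - q) (p - q)) + 2^-1 * (s * inner (p - r) (p - r)).
Proof.
move=> s0 cp lip.
have -> : inner c (p - q) = inner (c - c') (p - q) + inner c' p - inner c' q.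
  by rewrite !innerE; ring.
have h1 : - inner (c - c') (p - q) <= s * `|r - p| * `|p - q|.
  apply: le_trans (ler_norm _) _; rewrite normrN.
  by apply: le_trans (normr_inner_le _ _) _; exact: ler_wpM2r.
have h2 : s * `|r - p| * `|p - q| <=
   2^-1 * (s * inner (p - q) (p - q)) + 2^-1 * (s * inner (p - r) (p - r)).
  rewrite !inner_norm (distrC p r).
  have : 0 <= s * (`|r - p| - `|p - q|) ^+ 2 by rewrite mulr_ge0 ?sqr_ge0// ltW.
  rewrite sqrrB; lra.
lra.
Qed.

End lipschitz_operators.

(** * Causality *)

Section causality.

(** After k iterations of F the first k entries no longer change. *)
Lemma causal_fixpoint n (T : Type) (F : ('I_n -> T) -> 'I_n -> T) (x0 : 'I_n -> T) :
  (forall x y (i : 'I_n), (forall j : 'I_n, (j < i)%N -> x j = y j) -> F x i = F y i) ->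
  exists x, x = F x.
Proof.
move=> Fc; have stable k (i : 'I_n) : (i < k)%N -> iter k F x0 i = iter k.+1 F x0 i.
  elim: k i => // k IH i ik; apply: Fc => j ji; apply: IH.
  exact: leq_trans ji _.
by exists (iter n F x0); apply/funext => i; rewrite [LHS]stable.
Qed.

Lemma nondecreasing_vec_le r n (E : 'I_n -> 'I_r.+1) (i j : 'I_n) :
  nondecreasing_vec E -> (i <= j)%N -> (E i <= E j)%N.
Proof.
move=> [_ _ Es] ij; have [k kE] : exists k, (j = i + k :> nat)%N.
  by exists (j - i)%N; rewrite subnKC.
elim: k j {ij} kE => [|k IH] j jE; first by rewrite (_ : j = i)//; apply: val_inj; rewrite /= jE addn0.
have kn : (i + k < n)%N by apply: leq_trans (ltn_ord j); rewrite jE addnS.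
apply: leq_trans (IH (Ordinal kn) _) (Es _ _ _) => //=.
by rewrite jE addnS.
Qed.

Lemma nondecreasing_vec_lt r n (E : 'I_n -> 'I_r.+1) (i j : 'I_n) :
  nondecreasing_vec E -> (E i < E j)%N -> (i < j)%N.
Proof. by move=> Em; rewrite !ltnNge; apply: contra => /(nondecreasing_vec_le Em). Qed.

Context {R : realType} {X : hilbertType R}.

Lemma mxapp_eq_on r s (W : 'M[R]_(r, s)) (x y : 'I_s -> X) i :
  (forall j, W i j != 0 -> x j = y j) -> mxapp W x i = mxapp W y i.
Proof.
move=> xy; apply: eq_bigr => j _.
by have [->|/xy->//] := eqVneq (W i j) 0; rewrite !scale0r.
Qed.

Lemma supp_upto_neq0 r n (E : 'I_n -> 'I_r.+1) (W : 'M[R]_(n, r)) i (j : 'I_r) :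
  supp_upto E W -> W i j != 0 -> (j.+1 <= E i)%N.
Proof. by move=> EW; apply: contraR; rewrite -ltnNge => /EW ->. Qed.

Lemma supp_after_neq0 r n (E : 'I_n -> 'I_r.+1) (W : 'M[R]_(n, r)) i (j : 'I_r) :
  supp_after E W -> W i j != 0 -> (E i < j.+1)%N.
Proof. by move=> EW; rewrite ltnNge; apply: contra => /EW ->. Qed.

Lemma causal_lt n m (H : 'M[R]_(n, m)) (G : 'M[R]_(m, n)) (i : 'I_n) j (h : 'I_n) : causal H G^T ->
  H i j != 0 -> G j h != 0 -> (h < i)%N.
Proof.
move=> [E [Em EH EG]] Hij Gjh; apply: (nondecreasing_vec_lt Em).
apply: leq_trans (supp_upto_neq0 EH Hij).
by apply: (supp_after_neq0 EG); rewrite mxE.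
Qed.

(** F_i <= E_(i-1) <= E_i, with F_1 = 0, so the support of Q also obeys the
    bound given by E. *)
Lemma relatively_causal_supp n l (P Q RT : 'M[R]_(n, l)) : relatively_causal P Q RT ->
  exists E F : 'I_n -> 'I_l.+1, [/\ nondecreasing_vec E, nondecreasing_vec F,
    supp_upto E P /\ supp_upto E Q, supp_upto F Q & supp_after E RT /\ supp_after F P].
Proof.
move=> [E [F [[Em Fm FE] [FQ ER [FP EP]]]]]; exists E, F; split => //; split=> //.
move=> i j Eij; apply: FQ; apply: leq_ltn_trans Eij.
case: i => -[|i] hi; first by rewrite (let: And3 h _ _ := Fm in h).
have hi' : (i < n)%N by exact: ltnW.
apply: leq_trans (FE (Ordinal hi') (Ordinal hi) erefl) _.
exact: nondecreasing_vec_le.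
Qed.

Lemma relatively_causal_lt n l (P Q : 'M[R]_(n, l)) (W : 'M[R]_(l, n)) (i : 'I_n) j (h : 'I_n) :
  relatively_causal P Q W^T ->
  ((P - Q) i j != 0 -> W j h != 0 -> (h < i)%N) /\
  (Q i j != 0 -> P^T j h != 0 -> (h < i)%N).
Proof.
move=> /relatively_causal_supp[E [F [Em Fm [EP EQ] FQ [ER FP]]]]; split.
  move=> PQ Wjh; apply: (nondecreasing_vec_lt Em).
  apply: (@leq_trans j.+1); first by apply: (supp_after_neq0 ER); rewrite mxE.
  have [P0|] := eqVneq (P i j) 0; last exact: supp_upto_neq0.
  by apply: (supp_upto_neq0 EQ); move: PQ; rewrite !mxE P0 sub0r oppr_eq0.
move=> Qij Phj; apply: (nondecreasing_vec_lt Fm).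
apply: leq_trans (supp_upto_neq0 FQ Qij).
by apply: (supp_after_neq0 FP); rewrite mxE in Phj.
Qed.

End causality.

(** * The inclusions solved by x(z) *)

Section splitting.
Context {R : realType} {X : hilbertType R} {n m l : nat}.
Variables (A : 'I_n -> X -> set X) (B : 'I_m -> X -> X) (C : 'I_l -> X -> X).
Variables (M : 'M[R]_(n, n.-1)) (H : 'M[R]_(n, m)) (G : 'M[R]_(m, n)).
Variables (P Q : 'M[R]_(n, l)) (W : 'M[R]_(l, n)) (K : 'M[R]_n).
Hypothesis A_max : forall i, maximally_monotone (A i).
Hypothesis K_gt0 : forall i, 0 < K i i.
Hypothesis HG_causal : causal H G^T.
Hypothesis PQW_causal : relatively_causal P Q W^T.

(** If x = J_DA(v) then (v_i - x_i) / d_i lies in A_i x_i; this is that vector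
    for the argument v of the resolvents in the implicit equation. *)
Definition selected (z : 'I_n.-1 -> X) (x : 'I_n -> X) : 'I_n -> X :=
  mxapp M z - mxapp (half_lower K) x - mxapp H (componentwise B (mxapp G x))
  - mxapp (P - Q) (componentwise C (mxapp W x))
  - mxapp Q (componentwise C (mxapp P^T x)).

Definition consistent z x := forall i, A i (x i) (selected z x i).

Lemma stepsize_gt0 i : 0 < stepsize K 0 i.
Proof. by rewrite mxE divr_gt0. Qed.

Lemma mxapp_half_lower (x : 'I_n -> X) i :
  mxapp (half_lower K) x i = mxapp (slt K) x i + (K i i / 2) *: x i.
Proof. by rewrite mxappD !fctE mxapp_diag mxE. Qed.

Lemma xstepE z x i : xstep A B C M H G P Q W K z x i =
  resolvent (stepsize K 0 i) (A i)
    (x i + stepsize K 0 i *: selected z x i).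
Proof.
rewrite /xstep /resolventDA {1}/componentwise !fctE !mxapp_diag.
congr (resolvent _ _ _).
rewrite /selected !fctE mxapp_half_lower mxappN !fctE.
have xE : x i = (stepsize K 0 i * (K i i / 2)) *: x i.
  rewrite (_ : _ * _ = 1) ?scale1r// mxE mulrA divfK ?gt_eqF// divff//.
rewrite [X in _ = X + _]xE; move: (stepsize K 0 i) (K i i / 2) => d k.
by module_ring.
Qed.

Lemma xstep_causal z x y (i : 'I_n) : (forall j : 'I_n, (j < i)%N -> x j = y j) ->
  xstep A B C M H G P Q W K z x i = xstep A B C M H G P Q W K z y i.
Proof.
move=> xy; apply: (congr1 (resolvent (stepsize K 0 i) (A i))).
rewrite !fctE !mxapp_diag; congr (_ *: _ + _ - _ *: _ - _ *: _ - _ *: _).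
- by apply: mxapp_eq_on => j; rewrite !mxE; case: ifP => [ji _|]; rewrite ?oppr0 ?eqxx//; exact: xy.
- apply: mxapp_eq_on => j Hij; rewrite /componentwise; congr (B _ _).
  apply: mxapp_eq_on => h Gjh; apply: xy; exact: causal_lt Hij Gjh.
- apply: mxapp_eq_on => j Hij; rewrite /componentwise; congr (C _ _).
  apply: mxapp_eq_on => h Gjh; apply: xy.
  exact: (relatively_causal_lt i j h PQW_causal).1 Hij Gjh.
- apply: mxapp_eq_on => j Hij; rewrite /componentwise; congr (C _ _).
  apply: mxapp_eq_on => h Gjh; apply: xy.
  exact: (relatively_causal_lt i j h PQW_causal).2 Hij Gjh.
Qed.

(** By causality a fixed point of [xstep z] exists, so [xmap z] is one. *)
Lemma xmap_consistent z : consistent z (xmap A B C M H G P Q W K z).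
Proof.
have /(xgetPex (fun=> 0)) := causal_fixpoint (fun=> 0) (xstep_causal z).
rewrite -/(xmap A B C M H G P Q W K z); set x := xmap _ _ _ _ _ _ _ _ _ _ z => /= xE i.
have d0 := stepsize_gt0 i.
have [a] := resolventP (x i + stepsize K 0 i *: selected z x i) (A_max i) d0.
rewrite -xstepE -xE => Aa /addrI /(scalerI (lt0r_neq0 d0)) <- //.
Qed.

(** E_1 = F_1 = 0 makes the first rows of H, P and Q vanish. *)
Lemma selected_first z x (i : 'I_n) : i = 0%N :> nat ->
  selected z x i = mxapp M z i - (K i i / 2) *: x i.
Proof.
move=> i0.
have [E [Em EH _]] := HG_causal.
have [E' [F' [Em' Fm' [EP EQ] FQ _]]] := relatively_causal_supp PQW_causal.
have Ei : E i = 0%N :> nat by case: Em => h _ _; exact: h.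
have Ei' : E' i = 0%N :> nat by case: Em' => h _ _; exact: h.
have z0 r (V : 'M[R]_(n, r)) (y : 'I_r -> X) : (forall j, V i j = 0) -> mxapp V y i = 0.
  by move=> V0; rewrite /mxapp big1// => j _; rewrite V0 scale0r.
have H0 j : H i j = 0 by apply: EH; rewrite Ei.
have P0 j : P i j = 0 by apply: EP; rewrite Ei'.
have Q0 j : Q i j = 0 by apply: EQ; rewrite Ei'.
have PQ0 j : (P - Q) i j = 0 by rewrite !mxE P0 Q0 subrr.
have N0 j : slt K i j = 0 by rewrite mxE i0.
rewrite /selected !fctE mxapp_half_lower.
by rewrite (z0 _ _ _ N0) (z0 _ _ _ H0) (z0 _ _ _ PQ0) (z0 _ _ _ Q0) add0r !subr0.
Qed.

Lemma consistent_first z x (i : 'I_n) : i = 0%N :> nat -> consistent z x ->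
  x i = resolvent (stepsize K 0 i) (A i) (stepsize K 0 i *: mxapp M z i).
Proof.
move=> i0 /(_ i) Ai; apply/esym/(resolvent_eq (A_max i) (stepsize_gt0 i) Ai).
rewrite selected_first// scalerBr scalerA [X in X *: x i](_ : _ = 1) ?scale1r.
  by rewrite addrC subrK.
by rewrite mxE mulrA divfK ?gt_eqF// divff.
Qed.

End splitting.

(** * The Fejer inequality and the zeros of the sum *)

Section fejer_inequality.
Context {R : realType} {X : hilbertType R} {n m l t : nat}.
Variables (A : 'I_n -> X -> set X) (B : 'I_m -> X -> X) (C : 'I_l -> X -> X).
Variables (sigma : 'rV[R]_m) (L : 'rV[R]_l).
Variables (M : 'M[R]_(n, n.-1)) (H : 'M[R]_(n, m)) (G : 'M[R]_(m, n)).
Variables (P Q : 'M[R]_(n, l)) (W : 'M[R]_(l, n)) (K : 'M[R]_n) (U : 'M[R]_(n, t)).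
Hypothesis A_mono : forall i, monotone_op (A i).
Hypothesis sigma_gt0 : forall i, 0 < sigma 0 i.
Hypothesis B_coco : forall i, cocoercive (sigma 0 i) (B i).
Hypothesis L_gt0 : forall i, 0 < L 0 i.
Hypothesis C_mono : forall i, monotone_op (graph_of (C i)).
Hypothesis C_lip : forall i, (L 0 i).-lipschitz (C i).
Hypothesis H_sum : H^T *m const_mx 1 = const_mx 1 :> 'cV[R]_m.
Hypothesis G_sum : G *m const_mx 1 = const_mx 1 :> 'cV[R]_m.
Hypothesis Q_sum : Q^T *m const_mx 1 = const_mx 1 :> 'cV[R]_l.
Hypothesis P_sum : P^T *m const_mx 1 = const_mx 1 :> 'cV[R]_l.
Hypothesis W_sum : W *m const_mx 1 = const_mx 1 :> 'cV[R]_l.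
Hypothesis K_sym : K^T = K.
Hypothesis K_sum : (const_mx 1 : 'rV[R]_n) *m K *m (const_mx 1 : 'cV[R]_n) = 0.
Hypothesis K_def : K = M *m M^T + U *m U^T
       + 2^-1 *: ((H - G^T) *m invmx (diag_mx sigma) *m (H^T - G))
       + (P - Q) *m diag_mx L *m (P^T - Q^T)
       + (P - W^T) *m diag_mx L *m (P^T - W).

(** In this form the quadratic forms of K, on R^n and on X^n alike, are sums of
    squares with nonnegative weights. *)
Lemma K_weighted_grams : K = M *m diag_mx (const_mx 1) *m M^T + U *m diag_mx (const_mx 1) *m U^T
  + 2^-1 *: ((H - G^T) *m diag_mx (\row_i (sigma 0 i)^-1) *m (H - G^T)^T)
  + (P - Q) *m diag_mx L *m (P - Q)^T + (P - W^T) *m diag_mx L *m (P - W^T)^T.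
Proof.
by rewrite [LHS]K_def (invmx_diag sigma_gt0) !diag_const_mx !mulmx1 !trmxB !trmxK.
Qed.

Lemma K_ge_gram (v : 'cV[R]_n) : \sum_j ((M^T *m v) j 0) ^+ 2 <= (v^T *m K *m v) 0 0.
Proof.
have g0 s (V : 'M[R]_(n, s)) (d : 'rV[R]_s) : (forall j, 0 <= d 0 j) ->
    0 <= (v^T *m (V *m diag_mx d *m V^T) *m v) 0 0.
  by move=> d0; rewrite gram_form; apply: sumr_ge0 => j _; rewrite mulr_ge0// sqr_ge0.
have e : (v^T *m (M *m diag_mx (const_mx 1) *m M^T) *m v) 0 0 = \sum_j ((M^T *m v) j 0) ^+ 2.
  by rewrite gram_form; apply: eq_bigr => j _; rewrite mxE mul1r.
have /g0 gU : forall j : 'I_t, 0 <= (const_mx 1 : 'rV[R]_t) 0 j by move=> j; rewrite mxE.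
have /g0 gS : forall j : 'I_m, 0 <= (\row_i (sigma 0 i)^-1) 0 j.
  by move=> j; rewrite mxE invr_ge0 ltW.
have /g0 gL : forall j : 'I_l, 0 <= L 0 j by move=> j; exact: ltW.
pose f (V : 'M[R]_n) := (v^T *m V *m v) 0 0.
have fD V V' : f (V + V') = f V + f V' by rewrite /f mulmxDr mulmxDl mxE.
have fZ c V : f (c *: V) = c * f V by rewrite /f -scalemxAr -scalemxAl mxE.
rewrite -e -[leLHS]/(f _) -[leRHS]/(f K) K_weighted_grams !fD fZ.
rewrite -!addrA lerDl; apply: addr_ge0; first exact: gU.
apply: addr_ge0; first by apply: mulr_ge0; [rewrite invr_ge0|exact: gS].
by apply: addr_ge0; exact: gL.
Qed.

(** 0 = e^T K e >= |M^T e|^2. *)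
Lemma MT_ones : M^T *m const_mx 1 = 0 :> 'cV[R]_(n.-1).
Proof.
have := K_ge_gram (const_mx 1); rewrite trmx_const K_sum mxE => le0.
apply/matrixP => j k; rewrite ord1 [RHS]mxE.
apply/eqP; rewrite -sqrf_eq0 eq_le sqr_ge0 andbT; apply: le_trans le0.
by rewrite (bigD1 j)//= lerDl; apply: sumr_ge0 => i _; exact: sqr_ge0.
Qed.

Lemma M_col_sum0 j : \sum_i M i j = 0.
Proof.
have /matrixP/(_ j 0) := MT_ones; rewrite !mxE => Mj; rewrite -[RHS]Mj.
by apply: eq_bigr => i _; rewrite !mxE mulr1.
Qed.

(** K_ii = 0 would put the i-th basis vector into ker M^T, hence make it a
    multiple of e; this fails when there is a second index. *)
Lemma K_diag_gt0 i : (1 < n)%N ->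
  (forall v : 'cV[R]_n, M^T *m v = 0 -> exists c : R, v = c *: const_mx 1) ->
  0 < K i i.
Proof.
move=> n1 Mker.
have Kii : (delta_mx 0 i *m K *m delta_mx i 0 : 'M[R]_1) 0 0 = K i i.
  by rewrite -rowE -colE !mxE.
have := K_ge_gram (delta_mx i 0); rewrite trmx_delta Kii => leK.
move: leK; set e : 'cV[R]_n := delta_mx i 0 => leK.
have ge0 : 0 <= \sum_j ((M^T *m e) j 0) ^+ 2 by apply: sumr_ge0 => j _; exact: sqr_ge0.
rewrite lt_neqAle (le_trans ge0 leK) andbT; apply/negP => /eqP K0.
have /Mker[c /matrixP cE] : M^T *m e = 0.
  apply/matrixP => j k; rewrite ord1 [RHS]mxE; apply/eqP; rewrite -sqrf_eq0.
  have le0 : \sum_j ((M^T *m e) j 0) ^+ 2 <= 0 by rewrite [leRHS]K0.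
  have /eqP := le_anti (introT andP (conj le0 ge0)).
  by rewrite psumr_eq0 => [/allP/(_ j)|k' _]; [apply; exact: mem_index_enum|exact: sqr_ge0].
have [j ji] : exists j : 'I_n, j != i.
  have n0 : (0 < n)%N by exact: ltnW.
  have [i0|i0] := eqVneq (i : nat) 0%N.
    by exists (Ordinal n1); apply/eqP => /(congr1 val) /=; rewrite i0.
  by exists (Ordinal n0); apply/eqP => /(congr1 val) /= ei; rewrite -ei eqxx in i0.
have := cE j 0; have := cE i 0; rewrite !mxE !eqxx (negbTE ji) /= !mulr1 => <- /eqP.
by rewrite eq_sym oner_eq0.
Qed.

Lemma K_quadratic (x : 'I_n -> X) :
  prod_inner (mxapp K x) x =
    prod_inner (mxapp M^T x) (mxapp M^T x) + prod_inner (mxapp U^T x) (mxapp U^T x)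
    + 2^-1 * (\sum_j (sigma 0 j)^-1 * inner (mxapp (H - G^T)^T x j) (mxapp (H - G^T)^T x j))
    + (\sum_j L 0 j * inner (mxapp (P - Q)^T x j) (mxapp (P - Q)^T x j))
    + \sum_j L 0 j * inner (mxapp (P - W^T)^T x j) (mxapp (P - W^T)^T x j).
Proof.
rewrite {1}K_weighted_grams !mxappD mxappZ !prod_innerDl prod_innerZl !mxapp_weighted_gram.
congr (_ + _ + _ * _ + _ + _).
- by apply: eq_bigr => j _; rewrite mxE mul1r.
- by apply: eq_bigr => j _; rewrite mxE mul1r.
- by apply: eq_bigr => j _; rewrite mxE.
Qed.

Lemma half_lower_quadratic (x : 'I_n -> X) :
  prod_inner (mxapp (half_lower K) x) x = 2^-1 * prod_inner (mxapp K x) x.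
Proof.
rewrite [in RHS](half_lowerE K_sym) mxappD prod_innerDl.
have -> : prod_inner (mxapp (half_lower K)^T x) x = prod_inner (mxapp (half_lower K) x) x.
  by rewrite mxapp_adj trmxK prod_innerC.
by lra.
Qed.

Lemma selectedB z z' x (a : X) (D : 'I_n -> X) : D = x - (fun=> a) ->
  selected B C M H G P Q W K z x - selected B C M H G P Q W K z' (fun=> a) =
  mxapp M (z - z') - mxapp (half_lower K) D
  - mxapp H (componentwise B (mxapp G x) - (fun j => B j a))
  - mxapp (P - Q) (componentwise C (mxapp W x) - (fun j => C j a))
  - mxapp Q (componentwise C (mxapp P^T x) - (fun j => C j a)).
Proof.
move=> ->; rewrite !mxappBr /selected !(mxapp_cst1 _ G_sum, mxapp_cst1 _ P_sum, mxapp_cst1 _ W_sum).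
rewrite /componentwise; apply/funext => i; rewrite !fctE.
move: (mxapp _ _ _) (mxapp _ _ _) (mxapp _ _ _) (mxapp _ _ _) (mxapp _ _ _).
move: (mxapp _ _ _) (mxapp _ _ _) (mxapp _ _ _) (mxapp _ _ _) (mxapp _ _ _).
by move=> *; module_ring.
Qed.

(** With D = x - (a, ..., a), monotonicity of the A_i bounds the
    form of half_lower K at D, which is <K D, D> / 2, by <z - z', M^T D> plus the cross terms of B
    and C. Expanding K into its Gram summands, the Sigma- and L-parts dominate
    the cross terms, the U-part is nonnegative, and the M-part remains. *)
Lemma fejer_inequality z z' x (a : X) :
  consistent A B C M H G P Q W K z x ->
  consistent A B C M H G P Q W K z' (fun=> a) ->
  2^-1 * prod_inner (mxapp M^T x) (mxapp M^T x) <= prod_inner (z - z') (mxapp M^T x).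
Proof.
move=> zx za; pose D : 'I_n -> X := x - (fun=> a).
have De i : D i = x i - a by [].
have MD : mxapp M^T D = mxapp M^T x.
  rewrite mxappBr; apply/funext => j; rewrite !fctE mxapp_cst.
  under eq_bigr do rewrite mxE.
  by rewrite M_col_sum0 scale0r subr0.
have subst_row r (V : 'M[R]_(r, n)) j : V *m const_mx 1 = const_mx 1 :> 'cV[R]_r ->
    mxapp V D j = mxapp V x j - a.
  by move=> V1; rewrite mxappBr mxapp_cst1.
have : 0 <= prod_inner (selected B C M H G P Q W K z x
    - selected B C M H G P Q W K z' (fun=> a)) D.
  apply: sumr_ge0 => i _; rewrite innerC De; exact: A_mono (zx i) (za i).
rewrite (selectedB _ _ (erefl D)) !prod_innerBl.
rewrite half_lower_quadratic K_quadratic MD.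
rewrite (mxapp_adj M) MD prod_innerBl (mxapp_adj H) (mxapp_adj (P - Q)) (mxapp_adj Q).
set b := _ - (fun j => B j a); set c := _ - (fun j => C j a).
set c' := _ - (fun j => C j a).
have hB : - prod_inner b (mxapp H^T D) <=
   4^-1 * \sum_j (sigma 0 j)^-1 * inner (mxapp (H - G^T)^T D j) (mxapp (H - G^T)^T D j).
  rewrite /prod_inner -sumrN mulr_sumr; apply: ler_sum => j _.
  rewrite [in leRHS]trmxB trmxK mxappB !fctE.
  apply: cocoercive_cross => //.
  rewrite subst_row// inner_norm; exact: B_coco.
have hC : - prod_inner c (mxapp (P - Q)^T D) - prod_inner c' (mxapp Q^T D) <=
   2^-1 * (\sum_j L 0 j * inner (mxapp (P - Q)^T D j) (mxapp (P - Q)^T D j))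
   + 2^-1 * \sum_j L 0 j * inner (mxapp (P - W^T)^T D j) (mxapp (P - W^T)^T D j).
  rewrite /prod_inner -!sumrN -big_split/= !mulr_sumr -big_split/=.
  apply: ler_sum => j _.
  rewrite !trmxB trmxK !mxappB !fctE.
  apply: lipschitz_cross => //.
  - rewrite subst_row// innerC.
    exact: (C_mono (x := mxapp P^T x j) (y := a) (erefl (C j _)) (erefl (C j _))).
  - have subC (u v w : X) : (u - w) - (v - w) = u - v by rewrite opprB addrA subrK.
    rewrite !subst_row// /c /c' !fctE /componentwise !subC.
    exact: lipschitzE.
have := prod_inner_ge0 (mxapp U^T D).
lra.
Qed.

(** The column sums of M and P - Q vanish and those of H and Q are 1; only C at
    P^T x is left. *)
Lemma sum_selected z x :
  \sum_i selected B C M H G P Q W K z x i =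
  - (\sum_j (\sum_i half_lower K i j) *: x j) - (\sum_j B j (mxapp G x j))
  - \sum_j C j (mxapp P^T x j).
Proof.
rewrite /selected; under eq_bigr do rewrite !fctE.
rewrite !big_split/= !sumrN !sum_mxapp.
have -> : \sum_j (\sum_i M i j) *: z j = 0.
  by rewrite big1// => j _; rewrite M_col_sum0 scale0r.
have -> : \sum_j (\sum_i (P - Q) i j) *: componentwise C (mxapp W x) j = 0.
  rewrite big1// => j _; under eq_bigr do rewrite !mxE.
  by rewrite sumrB !col_sum1// subrr scale0r.
rewrite add0r subr0; congr (_ - _ - _).
  by apply: eq_bigr => j _; rewrite col_sum1// scale1r.
by apply: eq_bigr => j _; rewrite col_sum1// scale1r.
Qed.

Lemma selected_cst z (a : X) i :
  selected B C M H G P Q W K z (fun=> a) i =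
  mxapp M z i - (\sum_j half_lower K i j) *: a - (\sum_j H i j *: B j a)
  - \sum_j P i j *: C j a.
Proof.
rewrite /selected !fctE !(mxapp_cst1 _ G_sum, mxapp_cst1 _ P_sum, mxapp_cst1 _ W_sum).
rewrite mxappB !fctE mxapp_cst /componentwise /mxapp.
by move: (\sum_j Q i j *: _) => q; module_ring.
Qed.

Definition zeros_of : set X := zer (op_add (op_add (op_sum A)
  (op_sum (fun i => graph_of (B i)))) (op_sum (fun i => graph_of (C i)))).

Lemma zerosP a : zeros_of a <->
  exists2 u : 'I_n -> X, (forall i, A i a (u i)) &
    \sum_i u i + \sum_j B j a + \sum_j C j a = 0.
Proof.
split.
  move=> [_ [_ [u Au <-] [_ [b Bb <-] <-]] [_ [c Cc <-] E]].
  exists u => //; rewrite -[RHS]E; congr (_ + _ + _).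
    by apply: eq_bigr => j _; rewrite (Bb j).
  by apply: eq_bigr => j _; rewrite (Cc j).
move=> [u Au E].
exists (\sum_i u i + \sum_j B j a).
  by exists (\sum_i u i); [exists u|exists (\sum_j B j a) => //; exists (fun j => B j a)].
by exists (\sum_j C j a) => //; exists (fun j => C j a).
Qed.

Lemma consistent_zeros z a : consistent A B C M H G P Q W K z (fun=> a) -> zeros_of a.
Proof.
move=> zc; apply/zerosP; exists (selected B C M H G P Q W K z (fun=> a)) => //.
rewrite sum_selected (mxapp_cst1 _ G_sum) (mxapp_cst1 _ P_sum).
rewrite -scaler_suml exchange_big/= half_lower_cst// scale0r oppr0 add0r.
by rewrite addrAC subrK addNr.
Qed.

(** Solving [selected z (a, ..., a) = u] for M z gives a right-hand side w of
    mean zero, and M (S w) = w for such w. *)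
Lemma zeros_consistent a S : M *m S = 1%:M - n%:R^-1 *: const_mx 1 -> zeros_of a ->
  exists z, consistent A B C M H G P Q W K z (fun=> a).
Proof.
move=> MS /zerosP[u Au E].
pose w i := u i + (\sum_j half_lower K i j) *: a + (\sum_j H i j *: B j a)
  + \sum_j P i j *: C j a.
have w0 : \sum_i w i = 0.
  rewrite /w !big_split/= -scaler_suml half_lower_cst// scale0r addr0.
  rewrite (sum_mxapp H (fun j => B j a)) (sum_mxapp P (fun j => C j a)).
  rewrite -[RHS]E; congr (_ + _ + _).
    by apply: eq_bigr => j _; rewrite col_sum1// scale1r.
  by apply: eq_bigr => j _; rewrite col_sum1// scale1r.
exists (mxapp S w) => i; rewrite selected_cst -mxapp_mul MS mxapp_centering w0.
rewrite scaler0 subr0; set d := (X in A i a X).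
have -> : d = u i by rewrite /d /w; module_ring.
exact: Au.
Qed.

End fejer_inequality.

(** * Bounded and weakly convergent sequences *)

Section bounded_sequences.
Context {R : realType} {X : hilbertType R}.

Definition bounded_seq (u : nat -> X) := exists c, forall k, `|u k| <= c.

Lemma bounded_seqD u v : bounded_seq u -> bounded_seq v -> bounded_seq (fun k => u k + v k).
Proof.
move=> [c uc] [d vd]; exists (c + d) => k.
by apply: le_trans (ler_normD _ _) _; exact: lerD.
Qed.

Lemma bounded_seqB u v : bounded_seq u -> bounded_seq v -> bounded_seq (fun k => u k - v k).
Proof.
move=> [c uc] [d vd]; exists (c + d) => k.
by apply: le_trans (ler_normB _ _) _; exact: lerD.
Qed.

Lemma bounded_seq_mxapp r s (V : 'M[R]_(r, s)) (u : nat -> 'I_s -> X) i :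
  (forall j, bounded_seq (u^~ j)) -> bounded_seq (fun k => mxapp V (u k) i).
Proof.
move=> /choice[c uc]; exists (\sum_j `|V i j| * c j) => k.
apply: le_trans (ler_norm_sum _ _ _) _; apply: ler_sum => j _.
by rewrite normrZ ler_wpM2l.
Qed.

Lemma cvg_bounded_seq u (a : X) : u @ \oo --> a -> bounded_seq u.
Proof.
move=> ua; have /cvg_seq_bounded[M [_ Mb]] : cvgn u by apply/cvg_ex; exists a.
by exists (M + 1) => k; apply: (Mb (M + 1)) => //; rewrite ltrDl.
Qed.

Lemma lipschitz_bounded_seq (f : X -> X) k0 u : (forall x y, `|f x - f y| <= k0 * `|x - y|) ->
  0 <= k0 -> bounded_seq u -> bounded_seq (fun k => f (u k)).
Proof.
move=> fk k00 [c uc]; exists (k0 * (c + `|u 0%N|) + `|f (u 0%N)|) => k.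
rewrite -[f (u k)](subrK (f (u 0%N))); apply: le_trans (ler_normD _ _) _.
rewrite lerD2r; apply: le_trans (fk _ _) _; apply: ler_wpM2l => //.
by apply: le_trans (ler_normB _ _) _; rewrite lerD2r.
Qed.

End bounded_sequences.

Section weak_convergence.
Context {R : realType} {X : hilbertType R} (U : set_system nat) {FU : ProperFilter U}.

Definition weakly (u : nat -> X) (a : X) :=
  forall y, (fun k => inner (u k) y) @ U --> inner a y.

Lemma weaklyB u v a b : weakly u a -> weakly v b -> weakly (fun k => u k - v k) (a - b).
Proof.
move=> ua vb y; rewrite innerDl innerNl.
by under eq_fun do rewrite innerDl innerNl; apply: cvgB; [exact: ua|exact: vb].
Qed.

Lemma weaklyD u v a b : weakly u a -> weakly v b -> weakly (fun k => u k + v k) (a + b).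
Proof.
move=> ua vb y; rewrite innerDl.
by under eq_fun do rewrite innerDl; apply: cvgD; [exact: ua|exact: vb].
Qed.

Lemma cvg_weakly (u : nat -> X) a : u @ U --> a -> weakly u a.
Proof. by move=> ua y; apply: cvg_inner => //; exact: cvg_cst. Qed.

Lemma weakly_mxapp r s (V : 'M[R]_(r, s)) (u : nat -> 'I_s -> X) a i :
  (forall j, weakly (u^~ j) (a j)) -> weakly (fun k => mxapp V (u k) i) (mxapp V a i).
Proof.
move=> ua y; rewrite /mxapp inner_suml.
have -> : (fun k => inner (\sum_j V i j *: u k j) y) =
    (fun k => \sum_j V i j * inner (u k j) y).
  by apply/funext => k; rewrite inner_suml; apply: eq_bigr => j _; rewrite innerZl.
apply: cvg_sum => j _; rewrite innerZl; apply: cvgMl_tmp; exact: ua.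
Qed.

Lemma weakly_shift u v a : weakly u a -> (fun k => v k - u k) @ U --> (0 : X) -> weakly v a.
Proof.
move=> ua vu; have := weaklyD (cvg_weakly vu) ua; rewrite add0r.
by under [X in weakly X]eq_fun do rewrite subrK.
Qed.

Lemma weakly_prod_inner r
  (u : nat -> 'I_r -> X) a y : (forall j, weakly (fun k => u k j) (a j)) ->
  (fun k => prod_inner (u k) y) @ U --> prod_inner a y.
Proof. by move=> ua; apply: cvg_sum => j _; exact: ua. Qed.

End weak_convergence.

(** * Convergence of the iterates *)

Section convergence.
Context {R : realType} {X : hilbertType R} {n m l t : nat}.
Variables (A : 'I_n -> X -> set X) (B : 'I_m -> X -> X) (C : 'I_l -> X -> X).
Variables (sigma : 'rV[R]_m) (L : 'rV[R]_l).
Variables (M : 'M[R]_(n, n.-1)) (H : 'M[R]_(n, m)) (G : 'M[R]_(m, n)).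
Variables (P Q : 'M[R]_(n, l)) (W : 'M[R]_(l, n)) (K : 'M[R]_n) (U : 'M[R]_(n, t)).
Hypothesis n_ge2 : (2 <= n)%N.
Hypothesis A_max : forall i, maximally_monotone (A i).
Hypothesis sigma_gt0 : forall i, 0 < sigma 0 i.
Hypothesis B_coco : forall i, cocoercive (sigma 0 i) (B i).
Hypothesis L_gt0 : forall i, 0 < L 0 i.
Hypothesis C_mono : forall i, monotone_op (graph_of (C i)).
Hypothesis C_lip : forall i, (L 0 i).-lipschitz (C i).
Hypothesis M_ker : forall v : 'cV[R]_n, M^T *m v = 0 ->
  exists c : R, v = c *: const_mx 1.
Hypothesis H_sum : H^T *m const_mx 1 = const_mx 1 :> 'cV[R]_m.
Hypothesis G_sum : G *m const_mx 1 = const_mx 1 :> 'cV[R]_m.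
Hypothesis Q_sum : Q^T *m const_mx 1 = const_mx 1 :> 'cV[R]_l.
Hypothesis P_sum : P^T *m const_mx 1 = const_mx 1 :> 'cV[R]_l.
Hypothesis W_sum : W *m const_mx 1 = const_mx 1 :> 'cV[R]_l.
Hypothesis HG_causal : causal H G^T.
Hypothesis PQW_causal : relatively_causal P Q W^T.
Hypothesis K_sym : K^T = K.
Hypothesis K_sum : (const_mx 1 : 'rV[R]_n) *m K *m (const_mx 1 : 'cV[R]_n) = 0.
Hypothesis K_def : K = M *m M^T + U *m U^T
       + 2^-1 *: ((H - G^T) *m invmx (diag_mx sigma) *m (H^T - G))
       + (P - Q) *m diag_mx L *m (P^T - Q^T)
       + (P - W^T) *m diag_mx L *m (P^T - W).
Hypothesis zeros_neq0 : zeros_of A B C !=set0.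
Variables (gamma_ : nat -> R).
Hypothesis gamma_01 : forall k, 0 <= gamma_ k <= 1.
Hypothesis gamma_liminf : 0 < limn_inf (fun k => gamma_ k * (1 - gamma_ k)).
Variables (z : nat -> 'I_n.-1 -> X) (x : nat -> 'I_n -> X).
Hypothesis x_def : forall k, x k = xmap A B C M H G P Q W K (z k).
Hypothesis z_rec : forall k, z k.+1 = z k - gamma_ k *: mxapp M^T (x k).

Local Notation solves := (consistent A B C M H G P Q W K).
Local Notation v k := (mxapp M^T (x k)).

Lemma A_mono i : monotone_op (A i). Proof. exact: (A_max i).1. Qed.

Lemma K_gt0 i : 0 < K i i.
Proof. exact: (K_diag_gt0 sigma_gt0 L_gt0 K_def i n_ge2 M_ker). Qed.

Lemma xmap_solves y : solves y (xmap A B C M H G P Q W K y).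
Proof. exact: (xmap_consistent B C M A_max K_gt0 HG_causal PQW_causal). Qed.

Lemma x_solves k : solves (z k) (x k).
Proof. by rewrite x_def; exact: xmap_solves. Qed.

Lemma fejer y y' w a : solves y w -> solves y' (fun=> a) ->
  2^-1 * prod_inner (mxapp M^T w) (mxapp M^T w) <= prod_inner (y - y') (mxapp M^T w).
Proof.
exact: (fejer_inequality A_mono sigma_gt0 B_coco L_gt0 C_mono C_lip G_sum P_sum W_sum
  K_sym K_sum K_def).
Qed.

Lemma centering : exists S : 'M[R]_(n.-1, n), M *m S = 1%:M - n%:R^-1 *: const_mx 1.
Proof. by apply: centering_factor M_ker; exact: ltnW. Qed.

Lemma solution_exists : exists y a, solves y (fun=> a).
Proof.
have [a za] := zeros_neq0; have [S MS] := centering.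
have [y ya] := zeros_consistent Q H_sum G_sum P_sum W_sum K_sym K_sum MS za.
by exists y, a.
Qed.

Definition dist2 y k := prod_inner (z k - y) (z k - y).

(** Expand |z^(k+1) - y|^2 and use the Fejer inequality for the mixed term. *)
Lemma dist2_descent y a k : solves y (fun=> a) ->
  dist2 y k.+1 <= dist2 y k - gamma_ k * (1 - gamma_ k) * prod_inner (v k) (v k).
Proof.
move=> ya; rewrite /dist2 z_rec.
have -> : z k - gamma_ k *: v k - y = (z k - y) - gamma_ k *: v k by rewrite addrAC.
have h := fejer (x_solves k) ya.
rewrite prod_norm2B -/(dist2 y k).
have /andP[g0 _] := gamma_01 k; have := ler_wpM2l g0 h.
by move=> ?; lra.
Qed.

Lemma dist2_ge0 y k : 0 <= dist2 y k. Proof. exact: prod_inner_ge0. Qed.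

Lemma step_summable : exists c, 0 <= c /\
  forall k, \sum_(0 <= i < k) prod_inner (v i) (v i) <= c.
Proof.
have [y [a ya]] := solution_exists.
apply: (summable_of_descent (dist2_ge0 y) _ _ gamma_liminf).
- by move=> k; exact: prod_inner_ge0.
- by move=> k; have := gamma_01 k; nra.
- by move=> k; exact: dist2_descent ya.
Qed.

Lemma step_norm_cvg0 : (fun k => prod_inner (v k) (v k)) @ \oo --> (0 : R).
Proof.
have [c [_ vc]] := step_summable; apply: (summable_cvg0 _ vc) => k; exact: prod_inner_ge0.
Qed.

Lemma step_cvg0 j : (fun k => v k j) @ \oo --> (0 : X).
Proof.
apply: (cvg_norm_le0 _ (sqrtr_cvg0 step_norm_cvg0)); apply: nearW => k.
by rewrite -[leLHS]ger0_norm// -sqrtr_sqr ler_wsqrtr// -inner_norm; exact: inner_le_prod.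
Qed.

(** With M S = I - e e^T / n, subtracting the mean from x^k is applying S^T to
    M^T x^k, and w does not see the mean. *)
Lemma meanzero_cvg0 (w : 'I_n -> R) : \sum_i w i = 0 ->
  (fun k => \sum_i w i *: x k i) @ \oo --> (0 : X).
Proof.
move=> w0; have [S MS] := centering.
have ST : S^T *m M^T = 1%:M - n%:R^-1 *: const_mx 1.
  by rewrite -trmx_mul MS; apply/matrixP => i j; rewrite !mxE eq_sym.
have -> : (fun k => \sum_i w i *: x k i) = (fun k => \sum_i w i *: mxapp S^T (v k) i).
  apply/funext => k; rewrite -mxapp_mul ST.
  have e0 : \sum_i w i *: (n%:R^-1 *: \sum_j x k j) = 0.
    by rewrite -scaler_suml w0 scale0r.
  rewrite -[LHS]subr0 -[X in _ - X]e0 -sumrB.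
  apply: eq_bigr => i _; rewrite -scalerBr; congr (_ *: _).
  exact/esym/mxapp_centering.
rewrite -[X in _ --> X](_ : \sum_i w i *: \sum_j S^T i j *: (0 : X) = 0); last first.
  by apply: big1 => i _; rewrite big1 ?scaler0// => j _; rewrite scaler0.
apply: cvg_sum => i _; apply: cvgZl_tmp; apply: cvg_sum => j _; apply: cvgZl_tmp.
exact: step_cvg0.
Qed.

Lemma x_diff_cvg0 i j : (fun k => x k i - x k j) @ \oo --> (0 : X).
Proof.
pose w h : R := (h == i)%:R - (h == j)%:R.
have delta (V : lmodType R) (f : 'I_n -> V) i0 : \sum_h (h == i0)%:R *: f h = f i0.
  rewrite (bigD1 i0)//= eqxx scale1r big1 ?addr0// => h /negbTE ->.
  by rewrite scale0r.
have w0 : \sum_h w h = 0.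
  rewrite sumrB -[X in X - _]mulr1 -[X in _ - X]mulr1 !mulr_suml.
  by rewrite (delta R^o (fun=> 1) i) (delta R^o (fun=> 1) j) subrr.
have -> : (fun k => x k i - x k j) = (fun k => \sum_h w h *: x k h).
  apply/funext => k; under eq_bigr do rewrite scalerBl.
  by rewrite sumrB !delta.
exact: meanzero_cvg0.
Qed.

Let i1 : 'I_n := Ordinal (ltnW n_ge2).

Lemma solves_first y w : solves y w ->
  w i1 = resolvent (stepsize K 0 i1) (A i1) (stepsize K 0 i1 *: mxapp M y i1).
Proof. exact: (consistent_first (i := i1) A_max K_gt0 HG_causal PQW_causal erefl). Qed.

Lemma z_bounded j : bounded_seq (fun k => z k j).
Proof.
have [y [a ya]] := solution_exists.
have noninc k : dist2 y k <= dist2 y 0%N.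
  elim: k => // k IH; apply: le_trans (dist2_descent k ya) (le_trans _ IH).
  rewrite gerBl mulr_ge0 ?prod_inner_ge0//.
  by have := gamma_01 k; nra.
exists (Num.sqrt (dist2 y 0%N) + `|y j|) => k.
rewrite -[z k j](subrK (y j)); apply: le_trans (ler_normD _ _) _; rewrite lerD2r.
rewrite -[leLHS]ger0_norm// -sqrtr_sqr ler_wsqrtr// -inner_norm.
by apply: le_trans (noninc k); exact: (inner_le_prod (z k - y) j).
Qed.

(** x_1^k is a resolvent evaluated at a linear function of z^k, and the other
    entries differ from it by null sequences. *)
Lemma x_bounded i : bounded_seq (fun k => x k i).
Proof.
pose d := stepsize K 0 i1; have d0 : 0 < d by exact: stepsize_gt0 K_gt0 _.
have x1 : bounded_seq (fun k => x k i1).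
  have -> : (fun k => x k i1) = (fun k => resolvent d (A i1) (d *: mxapp M (z k) i1)).
    by apply/funext => k; exact: solves_first (x_solves k).
  apply: (lipschitz_bounded_seq (k0 := 1)) => //.
    by move=> u w; rewrite mul1r; exact: resolvent_nonexpansive.
  have [c zc] := bounded_seq_mxapp M i1 z_bounded; exists (d * c) => k.
  by rewrite normrZ gtr0_norm// ler_wpM2l// ltW.
have := bounded_seqD (cvg_bounded_seq (x_diff_cvg0 i i1)) x1.
by move=> [c xc]; exists c => k; have := xc k; rewrite subrK.
Qed.

Lemma B_lip j u w : `|B j u - B j w| <= (sigma 0 j)^-1 * `|u - w|.
Proof. exact: cocoercive_lipschitz. Qed.

Lemma B_bounded j : bounded_seq (fun k => B j (mxapp G (x k) j)).
Proof.
apply: (lipschitz_bounded_seq (B_lip j)); first by rewrite invr_ge0 ltW.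
exact: bounded_seq_mxapp x_bounded.
Qed.

Lemma C_bounded (V : 'M[R]_(l, n)) j : bounded_seq (fun k => C j (mxapp V (x k) j)).
Proof.
apply: (lipschitz_bounded_seq (lipschitzE (C_lip j))); first exact: ltW.
exact: bounded_seq_mxapp x_bounded.
Qed.

Lemma selected_bounded i :
  bounded_seq (fun k => selected B C M H G P Q W K (z k) (x k) i).
Proof.
rewrite /selected; do !apply: bounded_seqB.
- exact: bounded_seq_mxapp z_bounded.
- exact: bounded_seq_mxapp x_bounded.
- exact: bounded_seq_mxapp B_bounded.
- exact: bounded_seq_mxapp (C_bounded W).
- exact: bounded_seq_mxapp (C_bounded P^T).
Qed.

(** The arguments of all B_j and C_j are affine combinations of the entries
    of x^k, hence asymptotically equal to x_1^k. *)
Lemma mxapp_x_cvg0 r (V : 'M[R]_(r, n)) j : V *m const_mx 1 = const_mx 1 :> 'cV[R]_r ->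
  (fun k => mxapp V (x k) j - x k i1) @ \oo --> (0 : X).
Proof.
move=> /row_sum1 V1.
have -> : (fun k => mxapp V (x k) j - x k i1) = (fun k => \sum_h V j h *: (x k h - x k i1)).
  apply/funext => k; under [RHS]eq_bigr do rewrite scalerBr.
  by rewrite sumrB -scaler_suml V1 scale1r.
rewrite -[X in _ --> X](_ : \sum_h V j h *: (0 : X) = 0); last first.
  by apply: big1 => i _; rewrite scaler0.
by apply: cvg_sum => i _; apply: cvgZl_tmp; exact: x_diff_cvg0.
Qed.

(** The A_i, B_j and C_j as one family, to which [demiclosed_sum] applies. *)
Definition all_ops (i : 'I_n + 'I_m + 'I_l) : X -> set X :=
  match i with inl (inl i) => A i | inl (inr j) => graph_of (B j) | inr j => graph_of (C j) end.

(** The values fed to [demiclosed_sum] are the selected elements of A_i, the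
    B_j at G x^k and the C_j at P^T x^k: by [sum_selected] they add up to a
    combination of the x_i^k whose coefficients have sum 0. The C_j at R x^k
    have the same weak limits by Lipschitz continuity, so passing to the limit
    in [selected] gives [selected] at the limit. *)
Lemma cluster_solution (F : set_system nat) {UF : UltraFilter F} : \oo `<=` F ->
  exists y a, [/\ solves y (fun=> a), forall j, weakly F (fun k => z k j) (y j) &
    forall i, weakly F (fun k => x k i) a].
Proof.
move=> ooF.
have cF (V : topologicalType) (f : nat -> V) (a : V) : f @ \oo --> a -> f @ F --> a.
  by move=> fa S /fa; exact: ooF.
have wk (r : nat) (u : nat -> 'I_r -> X) : (forall j, bounded_seq (u^~ j)) ->
    exists a, forall j, weakly F (u^~ j) (a j).
  move=> ub; have /choice[a ua] j : exists a, weakly F (u^~ j) a.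
    by have [c uc] := ub j; exact: weak_ultra_cvg uc.
  by exists a.
have [y yP] := wk _ _ z_bounded; have [a' aP'] := wk _ _ x_bounded.
have [b bP] := wk _ _ B_bounded; have [c cP] := wk _ _ (C_bounded P^T).
pose a := a' i1.
have aP i : weakly F (fun k => x k i) a.
  by apply: weakly_shift (aP' i1) _; apply: cF; exact: x_diff_cvg0.
have cW j : weakly F (fun k => C j (mxapp W (x k) j)) (c j).
  apply: weakly_shift (cP j) _; apply: cF.
  apply: (@cvg_norm_le0 _ _ _ _ _ _
    (fun k => L 0 j * `|mxapp W (x k) j - mxapp P^T (x k) j|)).
    by apply: nearW => k; exact: lipschitzE.
  rewrite -(mulr0 (L 0 j)) -(normr0 X); apply: cvgMl_tmp; apply: cvg_norm.
  rewrite -(subrr (0 : X)).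
  have -> : (fun k => mxapp W (x k) j - mxapp P^T (x k) j) =
      (fun k => (mxapp W (x k) j - x k i1) - (mxapp P^T (x k) j - x k i1)).
    by apply/funext => k; rewrite opprB addrA subrK.
  exact: cvgB (mxapp_x_cvg0 j W_sum) (mxapp_x_cvg0 j P_sum).
pose s i := mxapp M y i - mxapp (half_lower K) (fun=> a) i - mxapp H b i
  - mxapp (P - Q) c i - mxapp Q c i.
have sP i : weakly F (fun k => selected B C M H G P Q W K (z k) (x k) i) (s i).
  rewrite /selected /s; do 4![apply: weaklyB; last exact: weakly_mxapp].
  exact: weakly_mxapp.
pose p k (i : 'I_n + 'I_m + 'I_l) := match i with inl (inl i) => x k i
  | inl (inr j) => mxapp G (x k) j | inr j => mxapp P^T (x k) j end.
pose q k (i : 'I_n + 'I_m + 'I_l) := match i with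
  inl (inl i) => selected B C M H G P Q W K (z k) (x k) i
  | inl (inr j) => B j (mxapp G (x k) j) | inr j => C j (mxapp P^T (x k) j) end.
pose qbar (i : 'I_n + 'I_m + 'I_l) := match i with inl (inl i) => s i
  | inl (inr j) => b j | inr j => c j end.
have [c1 c1P] := x_bounded i1.
have [c2 c2P] : exists c, forall k i, `|q k i| <= c.
  have /choice[e eP] i : bounded_seq (fun k => q k i).
    case: i => [[i|j]|j] /=; [exact: selected_bounded|exact: B_bounded|exact: C_bounded].
  exists (\sum_i `|e i|) => k i; apply: le_trans (eP i k) _.
  apply: le_trans (ler_norm _) _.
  by rewrite (bigD1 i)//= lerDl; apply: sumr_ge0.
have big_sum (f : 'I_n + 'I_m + 'I_l -> X) :
    \sum_i f i = \sum_i f (inl (inl i)) + \sum_i f (inl (inr i)) + \sum_i f (inr i).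
  by rewrite big_sumType /= big_sumType.
have sol : forall i, all_ops i a (qbar i).
  apply: (@demiclosed_sum _ _ F _ _ all_ops p q (x^~ i1) (Num.max c1 c2)).
  - case=> [[i|j]|j] /=.
    + by move=> w u; exact: maximally_monotone_mem.
    + apply: (lipschitz_graph_maximal _ (B_lip j)); by rewrite invr_gt0.
    + exact: (lipschitz_graph_maximal (L_gt0 j) (lipschitzE (C_lip j))).
  - case=> [[i|j]|j] /=; [exact: A_mono| |exact: C_mono].
    move=> u w _ _ -> ->; rewrite innerC; apply: le_trans (B_coco j u w).
    by rewrite mulr_ge0 ?exprn_ge0// ltW.
  - by move=> k [[i|j]|j] //=; exact: x_solves.
  - case=> [[i|j]|j] /=; apply: cF; [exact: x_diff_cvg0|exact: mxapp_x_cvg0|].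
    exact: mxapp_x_cvg0.
  - by move=> k; rewrite le_max c1P.
  - by move=> k i; rewrite le_max c2P orbT.
  - exact: aP.
  - by case=> [[i|j]|j] /=; [exact: sP|exact: bP|exact: cP].
  - apply: cF.
    have -> : (fun k => \sum_i q k i) =
        (fun k => - \sum_j (\sum_i half_lower K i j) *: x k j).
      apply/funext => k; rewrite big_sum /= (sum_selected B C sigma_gt0 L_gt0 H_sum Q_sum P_sum K_sum K_def).
      by rewrite addrAC subrK subrK.
    have w0 : \sum_j \sum_i half_lower K i j = 0.
      by rewrite exchange_big/=; exact: half_lower_cst.
    by rewrite -[X in _ --> X](oppr0 X); exact: cvgN (meanzero_cvg0 w0).
have bE : b = fun j => B j a by apply/funext => j; exact: (sol (inl (inr j))).
have cE : c = fun j => C j a by apply/funext => j; exact: (sol (inr j)).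
exists y, a; split=> // i.
rewrite /selected (mxapp_cst1 _ G_sum) (mxapp_cst1 _ P_sum) (mxapp_cst1 _ W_sum).
by have /= := sol (inl (inl i)); rewrite /s bE cE.
Qed.

Lemma dist2_cvg y a : solves y (fun=> a) -> exists d : R, dist2 y @ \oo --> d.
Proof.
move=> ya; apply/cvg_ex; apply: nonincreasing_is_cvgn.
  apply/nonincreasing_seqP => k; apply: le_trans (dist2_descent k ya) _.
  by rewrite gerBl mulr_ge0 ?prod_inner_ge0//; have := gamma_01 k; nra.
by exists 0 => _ [k _ <-]; exact: dist2_ge0.
Qed.

(** Opial: |z^k - y|^2 and |z^k - y'|^2 both converge, hence so does
    <z^k, y - y'>; its limits along F and F' are <y, y - y'> and
    <y', y - y'>. *)
Lemma cluster_unique (F F' : set_system nat) {UF : UltraFilter F} {UF' : UltraFilter F'}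
  y y' a a' : \oo `<=` F -> \oo `<=` F' ->
  solves y (fun=> a) -> solves y' (fun=> a') ->
  (forall j, weakly F (fun k => z k j) (y j)) ->
  (forall j, weakly F' (fun k => z k j) (y' j)) -> y = y'.
Proof.
move=> ooF ooF' ya ya' zy zy'.
have [d dP] := dist2_cvg ya; have [d' dP'] := dist2_cvg ya'.
pose e := 2^-1 * (prod_inner y y - prod_inner y' y' - d + d').
have eP : (fun k => prod_inner (z k) (y - y')) @ \oo --> e.
  have -> : (fun k => prod_inner (z k) (y - y')) = (fun k => 2^-1 *
     (prod_inner y y - prod_inner y' y' - dist2 y k + dist2 y' k)).
    apply/funext => k; rewrite /dist2 !prod_innerBl !(prod_innerC _ (_ - _)) !prod_innerBl.
    by rewrite (prod_innerC y) (prod_innerC y' (z k)); lra.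
  by apply: cvgMl_tmp; apply: cvgD => //; apply: cvgB => //; exact: cvg_cst.
have eF : (fun k => prod_inner (z k) (y - y')) @ F --> e by move=> S /eP; exact: ooF.
have eF' : (fun k => prod_inner (z k) (y - y')) @ F' --> e by move=> S /eP; exact: ooF'.
have h : prod_inner y (y - y') = e by exact: (cvg_unique _ (weakly_prod_inner (y := y - y') zy) eF).
have h' : prod_inner y' (y - y') = e by exact: (cvg_unique _ (weakly_prod_inner (y := y - y') zy') eF').
have : prod_inner (y - y') (y - y') = 0 by rewrite (prod_innerBl y y') h h' subrr.
move=> yy0; apply/funext => j; apply/eqP; rewrite -subr_eq0; apply/eqP/inner_eq0.
apply/eqP; rewrite eq_le inner_ge0 andbT -[leRHS]yy0.
exact: (inner_le_prod (y - y') j).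
Qed.

Lemma weak_convergence : exists y a, [/\ solves y (fun=> a),
  prod_weak_cvg z y & prod_weak_cvg x (fun=> a)].
Proof.
have [F0 [UF0 ooF0]] := ultraFilterLemma (@eventually_filter).
have [y [a [ya zy xa]]] := @cluster_solution F0 UF0 ooF0.
have uniq (F : set_system nat) : UltraFilter F -> \oo `<=` F ->
    (forall j, weakly F (fun k => z k j) (y j)) /\
    (forall i, weakly F (fun k => x k i) a).
  move=> UF ooF; have [y' [a' [ya' zy' xa']]] := @cluster_solution F UF ooF.
  have yy' : y' = y by exact: (@cluster_unique F F0 UF UF0 _ _ _ _ ooF ooF0 ya' ya zy' zy).
  have -> : a = a' by rewrite (solves_first ya) (solves_first ya') yy'.
  by rewrite -yy'.
exists y, a; split=> // u; apply: cvg_sum => j _; apply: cvg_ultra => F UF ooF.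
  exact: (uniq F UF ooF).1.
exact: (uniq F UF ooF).2.
Qed.

Variable gamma : R.
Hypothesis gamma_gt0 : 0 < gamma.
Local Notation T := (Top A B C M H G P Q W K gamma).

Lemma residual k : z k - T (z k) = gamma *: v k.
Proof. by rewrite /Top -x_def opprB addrC subrK. Qed.

Lemma residual_cvg0 : prod_cvg (fun k => z k - T (z k)) 0.
Proof.
rewrite /prod_cvg; under eq_fun do rewrite subr0 residual prod_normZ.
rewrite -(mulr0 `|gamma|); apply: cvgMl_tmp; exact: sqrtr_cvg0 step_norm_cvg0.
Qed.

Lemma residual_average :
  (fun k => prod_norm
     (k.+1%:R^-1 *: \sum_(0 <= s < k.+1) (z s - T (z s))) : R^o) =O_\oo
  (fun k => (Num.sqrt k%:R)^-1 : R^o).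
Proof.
have [c [c0 vc]] := step_summable.
apply/eqO_exP; exists (gamma * Num.sqrt c + 1).
  by rewrite ltr_wpDl// mulr_ge0 ?sqrtr_ge0// ltW.
exists 1%N => // k /= k1.
have k0 : 0 < k%:R :> R by rewrite ltr0n.
have k10 : 0 < k.+1%:R :> R by rewrite ltr0n.
have -> : \sum_(0 <= s < k.+1) (z s - T (z s)) = gamma *: \sum_(0 <= s < k.+1) v s.
  by rewrite scaler_sumr; apply: eq_bigr => s _; exact: residual.
set S := \sum_(0 <= s < k.+1) v s.
have SN : prod_norm S <= Num.sqrt k.+1%:R * Num.sqrt c.
  rewrite -sqrtrM ?ler0n// ler_wsqrtr//; apply: le_trans (prod_inner_sum_le _ _) _.
  by rewrite ler_wpM2l.
have sk : k.+1%:R^-1 * Num.sqrt k.+1%:R <= (Num.sqrt k%:R)^-1 :> R.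
  rewrite -{1}(sqr_sqrtr (ltW k10)) expr2 invfM -mulrA mulVf ?mulr1 ?gt_eqF ?sqrtr_gt0//.
  by rewrite lef_pV2 ?posrE ?sqrtr_gt0// ler_sqrt// ler_nat.
have sk0 : 0 <= (Num.sqrt k%:R)^-1 :> R by rewrite invr_ge0 sqrtr_ge0.
have nn : 0 <= prod_norm (k.+1%:R^-1 *: (gamma *: S)) by exact: sqrtr_ge0.
rewrite [X in X <= _](ger0_norm nn) [X in _ <= _ * X](ger0_norm sk0).
rewrite !prod_normZ (gtr0_norm gamma_gt0) gtr0_norm ?invr_gt0//.
rewrite mulrCA mulrDl mul1r; apply: (@le_trans _ _ (gamma * Num.sqrt c * (Num.sqrt k%:R)^-1)).
  rewrite -mulrA; apply: ler_wpM2l; first exact: ltW.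
  apply: (@le_trans _ _ (k.+1%:R^-1 * (Num.sqrt k.+1%:R * Num.sqrt c))).
    by apply: ler_wpM2l => //; rewrite invr_ge0 ltW.
  by rewrite mulrA mulrC; apply: ler_wpM2l => //; exact: sqrtr_ge0.
by rewrite lerDl.
Qed.

(** The Fejer inequality between (y, x(y)) and (y, (a, ..., a)) reads
    |M^T x(y)|^2 / 2 <= 0. *)
Lemma solves_fixpoint y a : solves y (fun=> a) -> Fix T y.
Proof.
move=> ya; have := fejer (xmap_solves y) ya; rewrite subrr.
set w := mxapp M^T _.
have -> : prod_inner (0 : 'I_n.-1 -> X) w = 0.
  by apply: big1 => j _; rewrite inner0l.
rewrite pmulr_rle0 ?invr_gt0// => w0; rewrite /Fix /= /Top -/w.
have -> : w = 0.
  apply/funext => j; apply: inner_eq0; apply/eqP; rewrite eq_le inner_ge0 andbT.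
  exact: le_trans (inner_le_prod w j) w0.
by rewrite scaler0 subr0.
Qed.

Theorem splitting_convergence :
  [/\ prod_cvg (fun k => z k - T (z k)) 0,
      (fun k => prod_norm
         (k.+1%:R^-1 *: \sum_(0 <= s < k.+1) (z s - T (z s))) : R^o) =O_\oo
      (fun k => (Num.sqrt k%:R)^-1 : R^o) &
      forall w : 'I_n -> R, \sum_i w i = 0 ->
        (fun k => \sum_i w i *: x k i) @ \oo --> (0 : X)] /\
  exists zbar : 'I_n.-1 -> X,
    (prod_weak_cvg z zbar /\ Fix T zbar) /\
    let xbar :=
      resolvent (stepsize K 0 i1) (A i1)
        (stepsize K 0 i1 *: \sum_j M i1 j *: zbar j) in
    prod_weak_cvg x (fun=> xbar) /\ zeros_of A B C xbar.
Proof.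
split; first by split; [exact: residual_cvg0|exact: residual_average|exact: meanzero_cvg0].
have [y [a [ya zy xa]]] := weak_convergence; exists y; split.
  by split=> //; exact: solves_fixpoint ya.
rewrite -(solves_first ya); split => //.
exact: (consistent_zeros sigma_gt0 L_gt0 H_sum G_sum Q_sum P_sum K_sym K_sum K_def ya).
Qed.

End convergence.

Theorem theorem4p1 (R : realType) (X : hilbertType R) (n m l t : nat)
    (n_ge2 : (2 <= n)%N) (t_ge1 : (1 <= t)%N)
    (A : 'I_n -> X -> set X) (B : 'I_m -> X -> X) (C : 'I_l -> X -> X)
    (sigma : 'rV[R]_m) (L : 'rV[R]_l)
    (A_max : forall i, maximally_monotone (A i))
    (sigma_gt0 : forall i, 0 < sigma 0 i)
    (B_coco : forall i, cocoercive (sigma 0 i) (B i))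
    (L_gt0 : forall i, 0 < L 0 i)
    (C_mono : forall i, monotone_op (graph_of (C i)))
    (C_lip : forall i, (L 0 i).-lipschitz (C i))
    (M : 'M[R]_(n, n.-1)) (H : 'M[R]_(n, m)) (G : 'M[R]_(m, n))
    (P Q : 'M[R]_(n, l)) (Rmx : 'M[R]_(l, n)) (K : 'M[R]_n) (U : 'M[R]_(n, t))
    (M_ker : forall v : 'cV[R]_n, M^T *m v = 0 ->
       exists c : R, v = c *: const_mx 1)
    (H_sum : H^T *m const_mx 1 = const_mx 1 :> 'cV[R]_m)
    (G_sum : G *m const_mx 1 = const_mx 1 :> 'cV[R]_m)
    (Q_sum : Q^T *m const_mx 1 = const_mx 1 :> 'cV[R]_l)
    (P_sum : P^T *m const_mx 1 = const_mx 1 :> 'cV[R]_l)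
    (R_sum : Rmx *m const_mx 1 = const_mx 1 :> 'cV[R]_l)
    (HG_causal : causal H G^T)
    (PQR_causal : relatively_causal P Q Rmx^T)
    (K_sym : K^T = K)
    (K_sum : (const_mx 1 : 'rV[R]_n) *m K *m (const_mx 1 : 'cV[R]_n) = 0)
    (K_psd : psd (K - M *m M^T
       - 2^-1 *: ((H - G^T) *m invmx (diag_mx sigma) *m (H^T - G))
       - (P - Q) *m diag_mx L *m (P^T - Q^T)
       - (P - Rmx^T) *m diag_mx L *m (P^T - Rmx)))
    (K_def : K = M *m M^T + U *m U^T
       + 2^-1 *: ((H - G^T) *m invmx (diag_mx sigma) *m (H^T - G))
       + (P - Q) *m diag_mx L *m (P^T - Q^T)
       + (P - Rmx^T) *m diag_mx L *m (P^T - Rmx))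
    (zeros : set X := zer (op_add (op_add (op_sum A)
       (op_sum (fun i => graph_of (B i)))) (op_sum (fun i => graph_of (C i)))))
    (zeros_neq0 : zeros !=set0)
    (gamma_ : nat -> R) (gamma_01 : forall k, 0 <= gamma_ k <= 1)
    (gamma_liminf : 0 < limn_inf (fun k => gamma_ k * (1 - gamma_ k)))
    (z : nat -> 'I_n.-1 -> X) (x : nat -> 'I_n -> X)
    (x_def : forall k, x k = xmap A B C M H G P Q Rmx K (z k))
    (z_rec : forall k, z k.+1 = z k - gamma_ k *: mxapp M^T (x k))
    (gamma : R) (gamma_gt0 : 0 < gamma)
    (T : ('I_n.-1 -> X) -> 'I_n.-1 -> X := Top A B C M H G P Q Rmx K gamma)
    (i1 : 'I_n := Ordinal (ltnW n_ge2)) :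
  [/\ prod_cvg (fun k => z k - T (z k)) 0,
      (fun k => prod_norm
         (k.+1%:R^-1 *: \sum_(0 <= s < k.+1) (z s - T (z s))) : R^o) =O_\oo
      (fun k => (Num.sqrt k%:R)^-1 : R^o) &
      forall w : 'I_n -> R, \sum_i w i = 0 ->
        (fun k => \sum_i w i *: x k i) @ \oo --> (0 : X)] /\
  exists zbar : 'I_n.-1 -> X,
    (prod_weak_cvg z zbar /\ Fix T zbar) /\
    let xbar :=
      resolvent (stepsize K 0 i1) (A i1)
        (stepsize K 0 i1 *: \sum_j M i1 j *: zbar j) in
    prod_weak_cvg x (fun=> xbar) /\ zeros xbar.
Proof.
exact: (splitting_convergence n_ge2 A_max sigma_gt0 B_coco L_gt0 C_mono C_lip M_ker
  H_sum G_sum Q_sum P_sum R_sum HG_causal PQR_causal K_sym K_sum K_def zeros_neq0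
  gamma_01 gamma_liminf x_def z_rec gamma_gt0).
Qed.
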